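(* Let $\alpha$ be a parameter and let $M_1=(n_1',\dots,n_{r_4}'\,|\,n_1,\dots,n_{r_1})$ and $M_2=(m_1',\dots,m_{r_3}'\,|\,m_1,\dots,m_{r_2})$ be Maya diagrams. Let $t_1'=t'(M_1)$ and $t_2'=t'(M_2)$ be the shifts bringing $M_1$, $M_2$ into conjugate canonical form. Then for $\lambda\notin\{m_1',\dots,m_{r_3}'\}$, up to a factor $\pm1$, $$\Omega_{M_1,M_2}\left[\widetilde h^{\alpha}(x,\lambda)\right]=D_1(\alpha,\lambda,M_1)\,D_2(\alpha,\lambda,M_2)\,D_3(\alpha,M_1,M_2)\,\Omega_{M_1+t_1',M_2+t_2'}\left[\widetilde h^{\alpha-t_1'-t_2'}(x,\lambda+t_1')\right],$$ where $$D_1=\begin{cases}\dfrac{(-\alpha)_{(|t_1'|)}}{\prod_{k_1'}(\lambda-k_1')} & t_1'<0,\\ 1 & t_1'=0,\\ \dfrac{(\lambda+1)^{(t_1')}}{(1-\alpha)^{(t_1')}} & t_1'>0,\end{cases}$$ the product over $k_1'\in\{0,\dots,|t_1'|-1\}$ with $k_1'\notin\{n_j\}_{j=1}^{r_1}$; $$D_2=\begin{cases}\dfrac{(-\alpha+t_1')_{(|t_2'|)}}{\prod_{k_2'}(-\lambda-\alpha-1-k_2')} & t_2'<0,\\ 1 & t_2'=0,\\ \dfrac{(-\lambda-\alpha)^{(t_2')}}{(1-\alpha+t_1')^{(t_2')}} & t_2'>0,\end{cases}$$ the product over $k_2'\in\{0,\dots,|t_2'|-1\}$ with $k_2'\notin\{m_j\}_{j=1}^{r_2}$;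 and $$D_3=\prod_{j=1}^{r_1}\prod_{k=1}^{r_3}(n_j+\alpha-m_k')\prod_{j=1}^{r_2}\prod_{k=1}^{r_4}(m_j+\alpha-n_k')\prod_{j=1}^{r_1}\prod_{k=1}^{r_4}(n_j+n_k'+1)\prod_{j=1}^{r_2}\prod_{k=1}^{r_3}(m_j+m_k'+1).$$
   Context: $L_n^{\beta}$ is the classical Laguerre polynomial; $M(a,b,x)={}_1F_1(a;b;x)$; $\widetilde h^{\beta}(x,\lambda)=x^{-\beta}M(-\lambda-\beta,1-\beta,x)$. Rising factorial $a^{(n)}=a(a+1)\cdots(a+n-1)$, falling factorial $a_{(n)}=a(a-1)\cdots(a-n+1)$, both $1$ for $n=0$. A Maya diagram is a set $M\subset\mathbb{Z}$ containing finitely many nonnegative integers and all but finitely many negative integers; it is encoded as $M=(n_1',\dots,n_{r_4}'\,|\,n_1,\dots,n_{r_1})$ where $n_1>\dots>n_{r_1}\ge0$ are the nonnegative elements of $M$ and $n_1'>\dots>n_{r_4}'\ge0$ are such that $-n_j'-1$ are exactly the negative integers not in $M$. For $t\in\mathbb{Z}$, $M+t=\{k+t:k\in M\}$. $M$ is in conjugate canonical form if it contains no nonnegative integer and $-1\in M$; $t'(M)$ denotes the unique integer with $M+t'(M)$ in conjugate canonical form. For Maya diagrams $M_1=(n'|n)$, $M_2=(m'|m)$ and a parameter $\beta$, set $r=r_1+r_2+r_3+r_4$, seed functions $f_j=L^{\beta}_{n_j}(x)$ ($1\le j\le r_1$), $f_{r_1+j}=e^xL^{\beta}_{m_j}(-x)$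 ($1\le j\le r_2$), $f_{r_1+r_2+j}=x^{-\beta}L^{-\beta}_{m_j'}(x)$ ($1\le j\le r_3$), $f_{r_1+r_2+r_3+j}=e^xx^{-\beta}L^{-\beta}_{n_j'}(-x)$ ($1\le j\le r_4$), and $$\Omega_{M_1,M_2}[\widetilde h^{\beta}(x,\lambda)]=e^{-(r_2+r_4)x}x^{(\beta+r_1+r_2)(r_3+r_4+1)}\,\mathrm{Wr}\left[f_1,\dots,f_r,\widetilde h^{\beta}(\cdot,\lambda)\right](x).$$ On the right-hand side the same construction is used with $M_1+t_1'$, $M_2+t_2'$ (re-encoded) and parameter $\beta=\alpha-t_1'-t_2'$. The paper ignores overall factors $(-1)^d$. *)

(* Defs.v *)
From HB Require Import structures.
From mathcomp Require Import all_boot all_order all_algebra.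
From mathcomp Require Import all_classical all_reals all_analysis.
Set Implicit Arguments. Unset Strict Implicit. Unset Printing Implicit Defensive.
Import Order.TTheory GRing.Theory Num.Theory numFieldNormedType.Exports.
Local Open Scope ring_scope.

Section Defs.
Variable R : realType.

Definition rfact (a : R) (n : nat) : R := \prod_(i < n) (a + i%:R).
Definition ffact (a : R) (n : nat) : R := \prod_(i < n) (a - i%:R).

(* classical Laguerre polynomial L_n^b(x)
   = sum_{k=0}^n (-1)^k binom(n+b, n-k) x^k / k!,
   binom(n+b, n-k) = (b+k+1)^(n-k) / (n-k)! *)
Definition laguerre (n : nat) (b x : R) : R :=
  \sum_(k < n.+1) (-1) ^+ k * (rfact (b + k.+1%:R) (n - k) / (n - k)`!%:R)
                  * x ^+ k / k`!%:R.

Definition kummerM (a b x : R) : R :=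
  limn (series (fun k : nat => rfact a k / rfact b k * x ^+ k / k`!%:R)).

Definition xpow (x b : R) : R := x `^ b.

Definition htilde (b lam : R) : R -> R :=
  fun x => xpow x (- b) * kummerM (- lam - b) (1 - b) x.

Definition wronskian (fs : seq (R -> R)) (x : R) : R :=
  \det (\matrix_(i < size fs, j < size fs) derive1n i (nth (fun _ => 0) fs j) x).

End Defs.

(* Maya diagram M = (n'_1,...,n'_{r4} | n_1,...,n_{r1}):
   mpos = [n_1;...;n_{r1}] (strictly decreasing nonnegative elements of M),
   mneg = [n'_1;...;n'_{r4}] (strictly decreasing, -n'_j-1 are exactly the
   negative integers not in M). *)
Record maya := Maya { mneg : seq nat; mpos : seq nat }.

Definition maya_wf (M : maya) : Prop :=
  sorted gtn (mneg M) /\ sorted gtn (mpos M).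

Definition maya_mem (M : maya) (k : int) : bool :=
  if (0 <= k)%R then `|k|%N \in mpos M else (`|k|.-1 \notin mneg M).

Definition mex (s : seq nat) : nat := find (fun j => j \notin s) (iota 0 (size s).+1).

Definition maya_max (M : maya) : int :=
  if mpos M is a :: _ then (a%:Z)%R else (- (mex (mneg M))%:Z - 1)%R.

(* t'(M): the integer t such that M + t is in conjugate canonical form *)
Definition tprime (M : maya) : int := (- 1 - maya_max M)%R.

Definition maya_shift (M : maya) (t : int) : maya :=
  let N := (foldr maxn 0 (mneg M) + foldr maxn 0 (mpos M) + `|t| + 1)%N in
  Maya (rev [seq j <- iota 0 N | ~~ maya_mem M ((- (j%:Z) - 1) - t)%R])
       (rev [seq j <- iota 0 N | maya_mem M ((j%:Z) - t)%R]).

Section Omega.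
Variable R : realType.
Local Open Scope ring_scope.

Definition Omega (M1 M2 : maya) (b : R) (h : R -> R) (x : R) : R :=
  let n := mpos M1 in let n' := mneg M1 in
  let m := mpos M2 in let m' := mneg M2 in
  let r1 := size n in let r2 := size m in
  let r3 := size m' in let r4 := size n' in
  let fs :=
    [seq (fun y : R => laguerre k b y) | k <- n] ++
    [seq (fun y : R => expR y * laguerre k b (- y)) | k <- m] ++
    [seq (fun y : R => xpow y (- b) * laguerre k (- b) y) | k <- m'] ++
    [seq (fun y : R => expR y * xpow y (- b) * laguerre k (- b) (- y)) | k <- n'] ++
    [:: h] in
  expR (- ((r2 + r4)%:R * x)) * xpow x ((b + (r1 + r2)%:R) * (r3 + r4).+1%:R)
    * wronskian fs x.

Definition D1den (al lam : R) (M1 : maya) : R :=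
  let t1 := tprime M1 in
  if (t1 < 0)%R then \prod_(k < `|t1|%N | nat_of_ord k \notin mpos M1) (lam - k%:R)
  else if (0 < t1)%R then rfact (1 - al) `|t1|%N else 1.

Definition D1num (al lam : R) (M1 : maya) : R :=
  let t1 := tprime M1 in
  if (t1 < 0)%R then ffact (- al) `|t1|%N
  else if (0 < t1)%R then rfact (lam + 1) `|t1|%N else 1.

Definition D1 (al lam : R) (M1 : maya) : R := D1num al lam M1 / D1den al lam M1.

Definition D2den (al lam : R) (M1 M2 : maya) : R :=
  let t1 := tprime M1 in let t2 := tprime M2 in
  if (t2 < 0)%R then \prod_(k < `|t2|%N | nat_of_ord k \notin mpos M2) (- lam - al - 1 - k%:R)
  else if (0 < t2)%R then rfact (1 - al + t1%:~R) `|t2|%N else 1.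

Definition D2num (al lam : R) (M1 M2 : maya) : R :=
  let t1 := tprime M1 in let t2 := tprime M2 in
  if (t2 < 0)%R then ffact (- al + t1%:~R) `|t2|%N
  else if (0 < t2)%R then rfact (- lam - al) `|t2|%N else 1.

Definition D2 (al lam : R) (M1 M2 : maya) : R :=
  D2num al lam M1 M2 / D2den al lam M1 M2.

Definition D3 (al : R) (M1 M2 : maya) : R :=
  let n := mpos M1 in let n' := mneg M1 in
  let m := mpos M2 in let m' := mneg M2 in
  (\prod_(a <- n) \prod_(b <- m') (a%:R + al - b%:R)) *
  (\prod_(a <- m) \prod_(b <- n') (a%:R + al - b%:R)) *
  (\prod_(a <- n) \prod_(b <- n') (a%:R + b%:R + 1)) *
  (\prod_(a <- m) \prod_(b <- m') (a%:R + b%:R + 1)).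

End Omega.

(* Main.v *)
Require Import Defs.
From HB Require Import structures.
From mathcomp Require Import all_boot all_order all_algebra.
From mathcomp Require Import all_classical all_reals all_analysis.
From mathcomp Require Import ring lra zify.
Set Implicit Arguments. Unset Strict Implicit. Unset Printing Implicit Defensive.
Import Order.TTheory GRing.Theory Num.Theory numFieldNormedType.Exports.
Local Open Scope classical_set_scope.
Local Open Scope ring_scope.

(** The families of seed functions are organised by the factors [1], [e^x], [x^-b],
    [e^x x^-b].  If the family contains the seed of degree 0 of one of these four
    kinds, that seed equals the factor [phi] itself, and dividing the whole
    family by [phi] and differentiating removes it from the Wronskian.  By the
    contiguous relations of the Laguerre polynomials and of Kummer's function,
    every other member [f] satisfies [(f / phi)' = c * psi * g] with a common
    [psi], where [g] is a seed for the parameter [b + 1] or [b - 1].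
    Up to sign this shifts one of the two Maya diagrams by one and multiplies
    [Omega] by the product of the constants [c].  When the diagram to be lowered
    does not contain 0, the relation is read backwards.  Iterating until both
    diagrams are in conjugate canonical form accumulates [D1 D2 D3].  No constant
    that has to be inverted vanishes: such a zero would make the final parameter
    a positive integer or kill the denominator of [D1] or [D2]. *)

(** * Reduction of order for Wronskians *)

(** The removed kind and the kind whose degrees rise differ in both factors [x^-b] and [e^x]. In
    [Omega] such a pair encodes the elements and the holes of one Maya diagram, which is why
    deleting degree 0, lowering one kind and raising the other amounts to a unit translation. The
    first diagram is treated before the second: its steps preserve [b - t1'] and [lam + b], the only
    combinations of [b], [lam], [t1'] in [D2], and once canonical it contributes no products over
    nonnegative elements. A forward lowering contributes [- b] to [D1]; a lowering read backwards
    contributes [- b / lam] with the current [lam]. Hence the denominator of [D1] runs over the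
    degrees missing from the diagram, and [D2] arises likewise with [- lam - b - 1] for [lam]. The
    obstacle is that only the initial and final parameters are assumed regular, while the Kummer
    relations need every intermediate one: each lowering requires [b != 0]. *)

Definition eqpos (R : realType) (f g : R -> R) : Prop := forall x, 0 < x -> f x = g x.

(** On positive arguments every real power is smooth. Smoothness has to be carried along because
    [derive1n] is total while the product rule requires differentiability. *)
Definition smooth_pos (R : realType) (f : R -> R) : Prop :=
  forall n x, 0 < x -> derivable (derive1n n f) x 1.

Section SmoothPos.
Variable R : realType.
Implicit Types (f g : R -> R) (x d : R).

Lemma is_derive_eqpos f g x d :
  eqpos f g -> 0 < x -> is_derive x 1 f d -> is_derive x 1 g d.
Proof.
move=> fg x0 [df <-].
have E : \near x, f x = g x.
  have : \near x, x \in `]0, +oo[ by apply: near_in_itvoy; rewrite in_itv /= x0.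
  by apply: filterS => y; rewrite in_itv /= andbT => y0; exact: fg.
by split; [exact: near_eq_derivable E df|rewrite (near_eq_derive _ E)].
Qed.

Lemma derive1_val f x d : is_derive x 1 f d -> derive1 f x = d.
Proof. by move=> [_ <-]; rewrite derive1E. Qed.

Lemma derivable_is_derive1 f x : derivable f x 1 -> is_derive x 1 f (derive1 f x).
Proof. by move=> df; rewrite derive1E; apply: derivableP. Qed.

Lemma derive1_eqpos f g : eqpos f g -> eqpos (derive1 f) (derive1 g).
Proof.
move=> fg x x0; rewrite !derive1E; apply: near_eq_derive.
have : \near x, x \in `]0, +oo[ by apply: near_in_itvoy; rewrite in_itv /= x0.
by apply: filterS => y; rewrite in_itv /= andbT => y0; exact: fg.
Qed.

Lemma derive1n_eqpos n f g : eqpos f g -> eqpos (derive1n n f) (derive1n n g).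
Proof. by move=> fg; elim: n => //= n; exact: derive1_eqpos. Qed.

Lemma smooth_pos_eq f g : eqpos f g -> smooth_pos f -> smooth_pos g.
Proof.
move=> fg sf n x x0.
by have [] := is_derive_eqpos (derive1n_eqpos n fg) x0 (derivable_is_derive1 (sf n x x0)).
Qed.

(** The family is closed under differentiation up to scalars, so every higher derivative is again a
    multiple of a member. Exponentials, powers, polynomials and Kummer functions are all
    instances. *)
Lemma smooth_pos_family (I : Type) (F : I -> R -> R) (c : I -> R) (nx : I -> I) :
  (forall i x, 0 < x -> is_derive x 1 (F i) (c i * F (nx i) x)) ->
  forall i, smooth_pos (F i).
Proof.
move=> H i n.
have E k : exists a j, eqpos (derive1n k (F i)) (fun y => a * F j y).
  elim: k => [|k [a [j E]]]; first by exists 1, i => x _; rewrite mul1r.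
  exists (a * c j), (nx j) => x x0 /=.
  rewrite (derive1_eqpos E x0) -mulrA; apply: derive1_val.
  exact: (is_deriveZ a (H j x x0)).
have [a [j Ej]] := E n.
move=> x x0; have D : is_derive x 1 (fun y => a * F j y) (a * (c j * F (nx j) x)).
  exact: (is_deriveZ a (H j x x0)).
by have [] := is_derive_eqpos (fun y y0 => esym (Ej y y0)) x0 D.
Qed.

Lemma derive1nM n f g : smooth_pos f -> smooth_pos g ->
  eqpos (derive1n n (fun y => f y * g y))
        (fun y => \sum_(k < n.+1) 'C(n, k)%:R * derive1n (n - k) f y * derive1n k g y).
Proof.
move=> sf sg; elim: n => [|n IHn] x x0 /=.
  by rewrite big_ord_recl big_ord0 /= mul1r addr0.
rewrite (derive1_eqpos IHn x0).
have D : is_derive x 1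
    (fun y => \sum_(k < n.+1) 'C(n, k)%:R * derive1n (n - k) f y * derive1n k g y)
    (\sum_(k < n.+1) (('C(n, k)%:R * derive1n (n - k) f x) * derive1n k.+1 g x +
       'C(n, k)%:R * derive1n (n - k).+1 f x * derive1n k g x)).
  have -> : (fun y => \sum_(k < n.+1) 'C(n, k)%:R * derive1n (n - k) f y * derive1n k g y)
     = \sum_(k < n.+1) (fun y => 'C(n, k)%:R * derive1n (n - k) f y * derive1n k g y).
    by apply/funext => y; rewrite fct_sumE.
  apply: is_derive_sum => k.
  have D1 := is_deriveZ ('C(n, k)%:R) (derivable_is_derive1 (sf (n - k)%N x x0)).
  have D2 := derivable_is_derive1 (sg k x x0).
  apply: (is_derive_eq (is_deriveM D1 D2)).
  by rewrite /GRing.scale /=; congr (_ + _); rewrite mulrC.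
rewrite (derive1_val D) big_split /= addrC.
rewrite [RHS]big_ord_recl [X in X + _]big_ord_recl /= !bin0 ?subn0 -addrA; congr (_ + _).
(* Adding the vanishing term with ['C(n, n.+1)] gives both sums the same range; Pascal's rule then
   joins them term by term. *)
rewrite [X in X + _](_ : _ = \sum_(k < n.+1) 'C(n, k.+1)%:R * derive1n (n - k) f x
   * derive1n k.+1 g x); last first.
  rewrite [RHS]big_ord_recr /= bin_small // mul0r mul0r addr0.
  apply: eq_bigr => k _; rewrite /= /bump /= add1n.
  have [kn|nk] := ltnP k n; first by rewrite -[in RHS](subnSK kn).
  by rewrite bin_small ?mul0r // ltnS.
rewrite -big_split /=; apply: eq_bigr => k _.
by rewrite /bump /= add1n subSS binS natrD -!mulrDl.
Qed.

Lemma smooth_posM f g : smooth_pos f -> smooth_pos g -> smooth_pos (fun y => f y * g y).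
Proof.
move=> sf sg n x x0.
pose S := fun y => \sum_(k < n.+1) 'C(n, k)%:R * derive1n (n - k) f y * derive1n k g y.
suff D : derivable S x 1.
  have E : eqpos S (derive1n n (fun y => f y * g y)).
    by move=> y y0; rewrite (derive1nM n sf sg y0).
  by have [] := is_derive_eqpos E x0 (derivable_is_derive1 D).
have -> : S = \sum_(k < n.+1) (fun y => 'C(n, k)%:R * derive1n (n - k) f y * derive1n k g y).
  by apply/funext => y; rewrite /S fct_sumE.
apply: derivable_sum => k.
have D1 : derivable (fun y => 'C(n, k)%:R * derive1n (n - k) f y) x 1.
  exact: (derivableZ (sf (n - k)%N x x0)).
exact: (derivableM D1 (sg k x x0)).
Qed.

(** Indexing by [nat] instead of a list turns deletion of column [p] into composition with
    [bump p]. *)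
Definition wr (n : nat) (F : nat -> R -> R) (x : R) : R :=
  \det (\matrix_(i < n, j < n) derive1n i (F j) x).

Lemma wr_eqpos n F G x : 0 < x ->
  (forall j, (j < n)%N -> eqpos (F j) (G j)) -> wr n F x = wr n G x.
Proof.
move=> x0 FG; congr (\det _); apply/matrixP => i j; rewrite !mxE.
exact: (derive1n_eqpos i (FG j (ltn_ord j)) x0).
Qed.

Lemma wrZ n (c : nat -> R) F x : 0 < x -> (forall j, (j < n)%N -> smooth_pos (F j)) ->
  wr n (fun j y => c j * F j y) x = (\prod_(j < n) c j) * wr n F x.
Proof.
move=> x0 sF.
have -> : \prod_(j < n) c j = \det (diag_mx (\row_(j < n) c j)).
  by rewrite det_diag; apply: eq_bigr => j _; rewrite mxE.
rewrite mulrC -det_mulmx; congr (\det _); apply/matrixP => i j.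
rewrite mul_mx_diag !mxE mulrC.
have E k : eqpos (derive1n k (fun y => c j * F j y)) (fun y => c j * derive1n k (F j) y).
  elim: k => [//|k IHk] y y0 /=; rewrite (derive1_eqpos IHk y0).
  exact: (derive1_val (is_deriveZ (c j) (derivable_is_derive1 (sF j (ltn_ord j) k y y0)))).
exact: E.
Qed.

(* The Wronskian matrix of [phi F] is that of [F] multiplied on the left by a
   lower triangular matrix with diagonal entries [phi x] (Leibniz rule). *)
Lemma wrM n phi F x : 0 < x -> smooth_pos phi ->
  (forall j, (j < n)%N -> smooth_pos (F j)) ->
  wr n (fun j y => phi y * F j y) x = phi x ^+ n * wr n F x.
Proof.
move=> x0 sphi sF.
pose T := \matrix_(i < n, k < n) ('C(i, k)%:R * derive1n (i - k) phi x).
have -> : phi x ^+ n = \det T.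
  rewrite det_trig; last first.
    by apply/is_trig_mxP => i j ij; rewrite mxE bin_small // mul0r.
  rewrite (eq_bigr (fun=> phi x)) ?prodr_const ?card_ord // => i _.
  by rewrite mxE binn subnn mul1r.
rewrite -det_mulmx; congr (\det _); apply/matrixP => i j; rewrite !mxE.
rewrite (derive1nM i sphi (sF j (ltn_ord j)) x0).
rewrite (eq_bigr (fun k : 'I_n => 'C(i, k)%:R * derive1n (i - k) phi x * derive1n k (F j) x));
  last by move=> k _; rewrite !mxE.
rewrite -(big_mkord xpredT
  (fun k => 'C(i, k)%:R * derive1n (i - k) phi x * derive1n k (F j) x)).
rewrite -[RHS](big_mkord xpredT
  (fun k => 'C(i, k)%:R * derive1n (i - k) phi x * derive1n k (F j) x)).
rewrite [RHS](big_cat_nat (n := i.+1)) //=.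
rewrite [X in _ + X]big_nat_cond [X in _ + X]big1 ?addr0 // => k /andP[/andP[ik _] _].
by rewrite bin_small // !mul0r.
Qed.

(** All derivatives of the constant column vanish, so expansion along it leaves one minor. Its rows
    start at the first derivative, hence it is the Wronskian of the derivatives. *)
Lemma wr_const1 n p F x : 0 < x -> (p <= n)%N -> eqpos (F p) (fun=> 1) ->
  wr n.+1 F x = (-1) ^+ p * wr n (fun j => derive1 (F (bump p j))) x.
Proof.
move=> x0 pn Fp; rewrite /wr (expand_det_col _ (Ordinal (pn : (p < n.+1)%N))).
rewrite big_ord_recl big1 ?addr0; last first.
  move=> i _; have E : eqpos (derive1n i.+1 (F p)) (fun=> 0).
    move=> y y0; rewrite (derive1n_eqpos _ Fp y0) derive1Sn.
    have d0 : derive1 (fun=> 1 : R) = (fun=> 0) by apply/funext => z; exact: derive1_cst.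
    rewrite d0; elim: (nat_of_ord i) => //= k IHk.
    have -> : derive1n k (fun=> 0 : R) = fun=> 0.
      by elim: k {IHk} => //= k ->; apply/funext => z; exact: derive1_cst.
    exact: derive1_cst.
  by rewrite mxE (_ : derive1n _ _ _ = 0) ?mul0r //; exact: E.
rewrite mxE /= Fp // mul1r /cofactor /= add0n; congr (_ * \det _).
by apply/matrixP => i j; rewrite !mxE -derive1Sn.
Qed.

Lemma wronskianE fs x : wronskian fs x = wr (size fs) (nth (fun=> 0) fs) x.
Proof. by []. Qed.

Lemma smooth_pos_cst (a : R) : smooth_pos (fun=> a).
Proof.
apply: (@smooth_pos_family unit (fun _ _ => a) (fun=> 0) id _ tt) => _ y _.
by rewrite mul0r; apply: is_derive_cst.
Qed.

Lemma smooth_pos_nth (T : Type) (F : T -> R -> R) (s : seq T) j :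
  (forall t, smooth_pos (F t)) -> smooth_pos (nth (fun=> 0) (map F s) j).
Proof.
move=> sF; elim: s j => [|t s IHs] [|j]; rewrite ?nth_nil /=.
- exact: smooth_pos_cst.
- exact: smooth_pos_cst.
- exact: sF.
- exact: IHs.
Qed.

(* Crum-type reduction of order: [f_t / phi] is differentiated for every other
   member [f_t] of the family. *)
Lemma wronskian_reduce (T : eqType) (F G : T -> R -> R) (c : T -> R) (s1 s2 : seq T)
    (phi phiV psi : R -> R) x : 0 < x ->
  smooth_pos phi -> smooth_pos phiV -> smooth_pos psi ->
  eqpos (fun y => phi y * phiV y) (fun=> 1) ->
  (forall t, smooth_pos (F t)) -> (forall t, smooth_pos (G t)) ->
  (forall (t : T) (y : R), 0 < y -> is_derive y 1 (fun z => phiV z * F t z) (psi y * (c t * G t y))) ->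
  wronskian (map F s1 ++ phi :: map F s2) x =
  (-1) ^+ size s1 * phi x ^+ (size s1 + size s2).+1 * psi x ^+ (size s1 + size s2) *
  (\prod_(t <- s1 ++ s2) c t) * wronskian (map G (s1 ++ s2)) x.
Proof.
move=> x0 sphi sphiV spsi phiK sF sG dF.
set N := (size s1 + size s2)%N.
have sz : size (map F s1 ++ phi :: map F s2) = N.+1.
  by rewrite size_cat /= !size_map addnS.
have sfs j : smooth_pos (nth (fun=> 0) (map F s1 ++ phi :: map F s2) j).
  rewrite nth_cat; case: ltnP => _; first exact: (@smooth_pos_nth _ F s1 j sF).
  case: (j - _)%N => [|k]; [exact: sphi|exact: (@smooth_pos_nth _ F s2 k sF)].
rewrite wronskianE sz.
have -> : wr N.+1 (nth (fun=> 0) (map F s1 ++ phi :: map F s2)) x =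
  wr N.+1 (fun j y => phi y *
     (phiV y * nth (fun=> 0) (map F s1 ++ phi :: map F s2) j y)) x.
  apply: wr_eqpos => // j _ y y0; rewrite mulrA.
  by have /= -> := phiK y y0; rewrite mul1r.
rewrite (@wrM N.+1 phi (fun j y => phiV y *
  nth (fun=> 0) (map F s1 ++ phi :: map F s2) j y) x x0 sphi
  (fun j _ => smooth_posM sphiV (sfs j))).
rewrite (@wr_const1 N (size s1)) //; [|exact: leq_addr|]; last first.
  by move=> y y0; rewrite nth_cat size_map ltnn subnn /= mulrC; apply: (phiK y y0).
(* The empty case is settled apart, by determinants of size 0, because the indexing [u] below needs
   a default element. *)
case: (posnP (size (s1 ++ s2))) => [sz0|szp].
  have N0 : N = 0%N by rewrite /N -size_cat.
  have E0 : s1 ++ s2 = [::] by apply/nilP; rewrite /nilp sz0.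
  rewrite N0 E0 big_nil wronskianE /= /wr !det_mx00; ring.
have [t0 _] : exists t, t \in s1 ++ s2.
  by case: (s1 ++ s2) szp => // t s _; exists t; rewrite inE eqxx.
pose u j := nth t0 (s1 ++ s2) j.
have -> : wr N (fun j => derive1 (fun y => phiV y *
      nth (fun=> 0) (map F s1 ++ phi :: map F s2) (bump (size s1) j) y)) x =
  wr N (fun j y => psi y * (c (u j) * G (u j) y)) x.
  apply: wr_eqpos => // j jN y y0.
  have -> : nth (fun=> 0) (map F s1 ++ phi :: map F s2) (bump (size s1) j) = F (u j).
    rewrite /bump /u !nth_cat size_map; case: (ltnP j (size s1)) => js.
      by rewrite add0n js (nth_map t0).
    have -> : (true + j < size s1)%N = false by apply/negbTE; rewrite -leqNgt; exact: leqW.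
    rewrite add1n subSn //= (nth_map t0) //.
    by rewrite ltn_subLR.
  exact: (derive1_val (dF (u j) y y0)).
have sGZ j : smooth_pos (fun y => c (u j) * G (u j) y).
  by apply: smooth_posM; [exact: smooth_pos_cst|exact: sG].
rewrite (@wrM N psi (fun j y => c (u j) * G (u j) y) x x0 spsi (fun j _ => sGZ j)).
rewrite (@wrZ N (fun j => c (u j)) (fun j => G (u j)) x x0 (fun j _ => sG (u j))).
rewrite wronskianE size_map size_cat -/N.
have -> : \prod_(t <- s1 ++ s2) c t = \prod_(j < N) c (u j).
  by rewrite (big_nth t0) size_cat big_mkord.
have -> : wr N (nth (fun=> 0) (map G (s1 ++ s2))) x = wr N (fun j => G (u j)) x.
  by apply: wr_eqpos => // j jN y _; rewrite (nth_map t0) // size_cat.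
by ring.
Qed.

End SmoothPos.

(** * Laguerre polynomials *)

Section Rfact.
Variable R : realType.
Implicit Types (a b : R) (n k : nat).

Lemma rfact0 a : rfact a 0 = 1. Proof. by rewrite /rfact big_ord0. Qed.

Lemma rfactS a n : rfact a n.+1 = rfact a n * (a + n%:R).
Proof. by rewrite /rfact big_ord_recr. Qed.

Lemma rfactSl a n : rfact a n.+1 = a * rfact (a + 1) n.
Proof.
rewrite /rfact big_ord_recl /= addr0; congr (_ * _); apply: eq_bigr => i _.
by rewrite /bump /= add1n -addrA -natr1 [1 + _]addrC.
Qed.

Lemma rfact_neq0 a n : (forall k, a + k%:R != 0) -> rfact a n != 0.
Proof. by move=> a0; rewrite /rfact; apply/prodf_neq0 => i _. Qed.

Lemma natrS n : n.+1%:R = n%:R + 1 :> R. Proof. by rewrite natr1. Qed.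

Lemma fact_natr_neq0 n : n`!%:R != 0 :> R.
Proof. by rewrite pnatr_eq0 -lt0n fact_gt0. Qed.

End Rfact.

Section Laguerre.
Variable R : realType.
Implicit Types (b x : R) (n k : nat).

Definition laguerre_poly n b : {poly R} :=
  \poly_(k < n.+1) ((-1) ^+ k * (rfact (b + k.+1%:R) (n - k) / (n - k)`!%:R) / k`!%:R).

Lemma laguerreE n b x : laguerre n b x = (laguerre_poly n b).[x].
Proof. by rewrite horner_poly; apply: eq_bigr => k _; rewrite [RHS]mulrAC. Qed.

Lemma laguerre_poly0 b : laguerre_poly 0 b = 1.
Proof.
apply/polyP => k; rewrite coef_poly coef1; case: k => [|k] //=.
by rewrite rfact0 !divr1 mulr1.
Qed.

Lemma coef_laguerre n b k : (laguerre_poly n b)`_k =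
  if (k < n.+1)%N then (-1) ^+ k * (rfact (b + k.+1%:R) (n - k) / (n - k)`!%:R) / k`!%:R
  else 0.
Proof. exact: coef_poly. Qed.

(** This relation and the next three differentiate [L], [e^-x L], [x^b L] and [x^b e^-x L]. They
    cover the four ways in which the weights of two kinds of seeds can differ. *)
Lemma deriv_laguerre n b : (laguerre_poly n.+1 b)^`() = - laguerre_poly n (b + 1).
Proof.
apply/polyP => k; rewrite coef_deriv -(mulr_natr _ k.+1) coefN !coef_laguerre ltnS.
case: ifP => kn; last by rewrite mul0r oppr0.
rewrite subSS exprS factS natrM !natrS.
have -> : b + 1 + (k%:R + 1) = b + (k%:R + 1 + 1) by ring.
by field; rewrite !fact_natr_neq0 /= -natrS pnatr_eq0.
Qed.

Lemma deriv_laguerreB n b :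
  (laguerre_poly n b)^`() - laguerre_poly n b = - laguerre_poly n (b + 1).
Proof.
apply/polyP => k; rewrite coefB coef_deriv -(mulr_natr _ k.+1) coefN !coef_laguerre !ltnS.
case: (ltngtP k n) => kn; last 2 first.
- by rewrite mul0r subr0 oppr0.
- by rewrite kn mul0r subnn !rfact0 sub0r.
(* This substitution removes the truncated subtractions before [field]. *)
have [m ->] : exists m, n = (k + m.+1)%N by exists (n - k.+1)%N; lia.
have -> : (k + m.+1 - k.+1 = m)%N by lia.
have -> : (k + m.+1 - k = m.+1)%N by lia.
rewrite exprS [rfact (b + 1 + _) _]rfactS rfactSl !factS !natrM !natrS.
have -> : b + 1 + (k%:R + 1) = b + (k%:R + 1 + 1) by ring.
have -> : b + (k%:R + 1) + 1 = b + (k%:R + 1 + 1) by ring.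
by field; rewrite !fact_natr_neq0 /= -!natrS !pnatr_eq0.
Qed.

Lemma deriv_laguerreX n b :
  'X * (laguerre_poly n b)^`() + b *: laguerre_poly n b
  = (n%:R + b) *: laguerre_poly n (b - 1).
Proof.
apply/polyP => k; rewrite coefD coefXM !coefZ coef_deriv.
have -> : (if k == 0 then 0 else (laguerre_poly n b)`_k.-1.+1 *+ k.-1.+1) =
   k%:R * (laguerre_poly n b)`_k.
  by case: k => [|k] /=; rewrite ?mul0r // mulr_natl.
rewrite -mulrDl !coef_laguerre ltnS; case: leqP => kn; last by rewrite !mulr0.
have [m ->] : exists m, n = (k + m)%N by exists (n - k)%N; lia.
have -> : (k + m - k = m)%N by lia.
(* The trivial equation is expanded at its first factor on one side and at its last on the other;
   this links the rising factorials based at [b + k] and [b + k + 1]. *)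
have : rfact (b + k%:R) m.+1 = rfact (b + k%:R) m.+1 by [].
rewrite {1}rfactSl rfactS !natrS natrD => E.
have -> : b - 1 + (k%:R + 1) = b + k%:R by ring.
have -> : b + (k%:R + 1) = b + k%:R + 1 by ring.
transitivity ((-1) ^+ k / m`!%:R / k`!%:R * ((b + k%:R) * rfact (b + k%:R + 1) m)).
  by ring.
by rewrite E; ring.
Qed.

Lemma deriv_laguerreXB n b :
  'X * (laguerre_poly n b)^`() + (b *: laguerre_poly n b - 'X * laguerre_poly n b)
  = n.+1%:R *: laguerre_poly n.+1 (b - 1).
Proof.
apply/polyP => k; rewrite coefD coefB !coefXM !coefZ coef_deriv.
case: k => [|k] /=.
  rewrite add0r subr0 !coef_laguerre /= !subn0 !expr0 !mul1r !divr1.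
  have -> : b - 1 + 1%:R = b by ring.
  rewrite factS natrM rfactSl (natrS _ n).
  by field; rewrite fact_natr_neq0 /= -natrS pnatr_eq0.
rewrite -(mulr_natr _ k.+1) !coef_laguerre !ltnS; case: (ltngtP k n) => kn; last 2 first.
- by rewrite mul0r !mulr0 subr0 addr0.
- rewrite kn mul0r subnn !rfact0 mulr0 !add0r subnn rfact0 exprS factS natrM fact0 !natrS.
  by field; rewrite fact_natr_neq0 /= -natrS pnatr_eq0.
have [m ->] : exists m, n = (k + m.+1)%N by exists (n - k.+1)%N; lia.
have -> : (k + m.+1 - k.+1 = m)%N by lia.
rewrite subSS.
have -> : (k + m.+1 - k = m.+1)%N by lia.
rewrite exprS !rfactSl !factS !natrM !natrS natrD natrS.
have -> : b - 1 + (k%:R + 1 + 1) = b + (k%:R + 1) by ring.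
have -> : b + (k%:R + 1) + 1 = b + (k%:R + 1 + 1) by ring.
by field; rewrite !fact_natr_neq0 /= -!natrS !pnatr_eq0.
Qed.

End Laguerre.

(** * Kummer's function *)

Section Kummer.
Variable R : realType.
Implicit Types (a c x l : R) (u v : nat -> R).

Definition kummer_coef a c (k : nat) : R := rfact a k / rfact c k / k`!%:R.

Lemma kummerME a c : kummerM a c = fun x => limn (pseries (kummer_coef a c) x).
Proof.
apply/funext => x; rewrite /kummerM; congr (limn (series _)); apply/funext => k.
by rewrite /kummer_coef [RHS]mulrAC.
Qed.

(** Beyond [|c| + 1] the distance is at least 1, and below it there are finitely many [k] over which
    to take a minimum. *)
Lemma shifted_away_from0 c : (forall k, c + k%:R != 0) ->
  exists2 d, 0 < d & forall k, d <= `|c + k%:R|.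
Proof.
move=> c0; set N := Num.bound (`|c| + 1).
have [d d0 dN] : exists2 d, 0 < d & forall k, (k < N)%N -> d <= `|c + k%:R|.
  elim: N => [|N [d d0 IH]]; first by exists 1.
  exists (Num.min d `|c + N%:R|); first by rewrite lt_min d0 normr_gt0 c0.
  move=> k; rewrite ltnS leq_eqVlt ge_min => /orP[/eqP ->|kN]; first by rewrite lexx orbT.
  by rewrite IH.
exists (Num.min d 1); first by rewrite lt_min d0 ltr01.
move=> k; rewrite ge_min; case: (ltnP k N) => kN; first by rewrite dN.
apply/orP; right.
have h1 : `|c| + 1 < N%:R by apply: archi_boundP; rewrite addr_ge0.
have h2 : N%:R <= k%:R :> R by rewrite ler_nat.
have h3 : - c <= `|c| by rewrite -normrN ler_norm.
by apply: le_trans (ler_norm _); lra.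
Qed.

(** Each quotient [(a + k) / (c + k) = 1 + (a - c) / (c + k)] is bounded uniformly in [k]. Geometric
    growth suffices, since the remaining [1 / k!] lets an exponential series dominate for every
    [x]. *)
Lemma rfact_ratio_bound a c : (forall k, c + k%:R != 0) ->
  exists2 B, 0 <= B & forall k, `|rfact a k / rfact c k| <= B ^+ k.
Proof.
move=> c0; have [d d0 dc] := shifted_away_from0 c0.
exists (1 + `|a - c| / d); first by rewrite addr_ge0 // divr_ge0 // ltW.
elim=> [|k IHk]; first by rewrite !rfact0 divr1 normr1.
rewrite !rfactS exprSr invfM mulrACA normrM ler_pM // normrM normfV.
rewrite ler_pdivrMr ?normr_gt0 // mulrDl mul1r.
have -> : a + k%:R = (c + k%:R) + (a - c) by ring.
apply: le_trans (ler_normD _ _) _; rewrite lerD2l -mulrA ler_peMr //.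
by rewrite mulrC ler_pdivlMr // mul1r.
Qed.

Lemma is_cvg_kummer a c x : (forall k, c + k%:R != 0) ->
  cvgn (pseries (kummer_coef a c) x).
Proof.
move=> c0; have [B B0 Bk] := rfact_ratio_bound a c0.
apply: normed_cvg; apply: series_le_cvg (is_cvg_series_exp_coeff (B * `|x|)) => k.
- exact: normr_ge0.
- by rewrite /exp_coeff /= divr_ge0 // exprn_ge0 // mulr_ge0.
- rewrite /exp_coeff /kummer_coef /= exprMn !normrM normrX mulrAC !normfV.
  rewrite normr_nat ler_wpM2r ?invr_ge0 // ler_wpM2r ?exprn_ge0 //.
  by rewrite -normfV -normrM.
Qed.

Lemma cvg_kummer a c x : (forall k, c + k%:R != 0) ->
  pseries (kummer_coef a c) x @ \oo --> kummerM a c x.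
Proof. by move=> c0; rewrite kummerME; exact: is_cvg_kummer. Qed.

Lemma cvg_pseriesZ s u x l :
  pseries u x @ \oo --> l -> pseries (fun k => s * u k) x @ \oo --> s * l.
Proof.
move=> ul; have -> : pseries (fun k => s * u k) x = fun n => s * pseries u x n.
  apply/funext => n; rewrite /pseries /series /= mulr_sumr.
  by apply: eq_bigr => k _; rewrite mulrA.
exact: cvgMr.
Qed.

Lemma cvg_pseriesD u v x l m : pseries u x @ \oo --> l -> pseries v x @ \oo --> m ->
  pseries (fun k => u k + v k) x @ \oo --> l + m.
Proof.
move=> ul vm; have -> : pseries (fun k => u k + v k) x =
    fun n => pseries u x n + pseries v x n.
  apply/funext => n; rewrite /pseries /series /= -big_split /=.
  by apply: eq_bigr => k _; rewrite mulrDl.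
exact: cvgD.
Qed.

Lemma cvg_pseriesX u x l : pseries u x @ \oo --> l ->
  pseries (fun k => if k is j.+1 then u j else 0) x @ \oo --> x * l.
Proof.
move=> ul; rewrite -cvg_shiftS.
have -> : [sequence pseries (fun k => if k is j.+1 then u j else 0) x n.+1]_n =
    fun n => x * pseries u x n.
  apply/funext => n; rewrite /pseries /series /= big_nat_recl //= mul0r add0r mulr_sumr.
  by apply: eq_bigr => k _; rewrite exprS mulrCA.
exact: cvgMr.
Qed.

Lemma kummer_coef_diffs a c : (forall k, c + k%:R != 0) ->
  pseries_diffs (kummer_coef a c) = fun k => a / c * kummer_coef (a + 1) (c + 1) k.
Proof.
move=> c0; apply/funext => k; rewrite /pseries_diffs /kummer_coef !rfactSl factS natrM.
have := c0 0%N; rewrite addr0 => c00.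
have c1 : rfact (c + 1) k != 0.
  by apply: rfact_neq0 => j; rewrite -addrA [1 + _]addrC natr1.
by field; rewrite fact_natr_neq0 c1 c00 /= addrC natr1 pnatr_eq0.
Qed.

Lemma shifted_neq0S c : (forall k, c + k%:R != 0) -> forall k, c + 1 + k%:R != 0.
Proof. by move=> c0 k; rewrite -addrA [1 + _]addrC natr1. Qed.

Lemma cvg_kummer_diffs a c x : (forall k, c + k%:R != 0) ->
  pseries (pseries_diffs (kummer_coef a c)) x @ \oo -->
  a / c * kummerM (a + 1) (c + 1) x.
Proof.
move=> c0; rewrite kummer_coef_diffs //.
by apply: cvg_pseriesZ; apply: cvg_kummer; exact: shifted_neq0S.
Qed.

Lemma is_derive_kummer a c x : (forall k, c + k%:R != 0) ->
  is_derive x 1 (kummerM a c) (a / c * kummerM (a + 1) (c + 1) x).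
Proof.
move=> c0; rewrite -(cvg_lim _ (@cvg_kummer_diffs a c x c0)) // kummerME.
have c1 := shifted_neq0S c0; have c2 := shifted_neq0S c1.
(* Termwise differentiation at [x] asks for convergence of the series and of its first two derived
   series at a point of larger modulus. *)
apply: (@pseries_snd_diffs _ _ (`|x| + 1)).
- exact: is_cvg_kummer.
- by apply: cvgP; exact: cvg_kummer_diffs.
- rewrite kummer_coef_diffs //.
  have -> : pseries_diffs (fun k => a / c * kummer_coef (a + 1) (c + 1) k) =
      fun k => a / c * pseries_diffs (kummer_coef (a + 1) (c + 1)) k.
    by apply/funext => k; rewrite /pseries_diffs mulrCA.
  by apply: cvgP; apply: cvg_pseriesZ; exact: cvg_kummer_diffs.
- by rewrite [ltRHS]ger0_norm ?addr_ge0 // ltrDl.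
Qed.

(** Reduces an identity between Kummer functions to one between coefficients; the contiguous
    relations below all go through it. *)
Lemma cvg_pseries_eq u v x l m : pseries u x @ \oo --> l ->
  pseries v x @ \oo --> m -> u =1 v -> l = m.
Proof. by move=> ul + /funext E; rewrite -E => um; rewrite -(cvg_lim _ ul) // -(cvg_lim _ um). Qed.

Lemma kummer_coefS a c k : (forall k, c + k%:R != 0) ->
  kummer_coef a c k.+1 * k.+1%:R = kummer_coef a c k * ((a + k%:R) / (c + k%:R)).
Proof.
move=> c0; rewrite /kummer_coef !rfactS factS natrM.
by field; rewrite fact_natr_neq0 c0 rfact_neq0 //= addrC natr1 pnatr_eq0.
Qed.

Lemma kummer_coef_c1 a c k : (forall k, c + k%:R != 0) ->
  kummer_coef a (c + 1) k = c / (c + k%:R) * kummer_coef a c k.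
Proof.
move=> c0; have : rfact c k.+1 = rfact c k.+1 by [].
rewrite {1}rfactSl rfactS /kummer_coef => E; have c00 := c0 0%N; rewrite addr0 in c00.
have -> : rfact (c + 1) k = rfact c k * (c + k%:R) / c by rewrite -E mulrC mulKf.
by field; rewrite fact_natr_neq0 c0 c00 rfact_neq0.
Qed.

(** The left side is [e^x (e^-x M)']. *)
Lemma kummer_derivB a c x : (forall k, c + k%:R != 0) ->
  a / c * kummerM (a + 1) (c + 1) x - kummerM a c x =
  (a - c) / c * kummerM a (c + 1) x.
Proof.
move=> c0; rewrite -(mulN1r (kummerM a c x)).
have L := cvg_pseriesD (@cvg_kummer_diffs a c x c0)
  (@cvg_pseriesZ (-1) _ _ _ (@cvg_kummer a c x c0)).
have r := @cvg_pseriesZ ((a - c) / c) _ _ _ (@cvg_kummer a (c + 1) x (shifted_neq0S c0)).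
apply: (cvg_pseries_eq L r) => k.
rewrite /pseries_diffs mulrC kummer_coefS // kummer_coef_c1 //.
by field; rewrite c0 /=; have := c0 0%N; rewrite addr0.
Qed.

Lemma kummer_coef_cB a c k : (forall k, c - 1 + k%:R != 0) ->
  (c - 1) * kummer_coef a (c - 1) k = (c - 1 + k%:R) * kummer_coef a c k.
Proof.
move=> c0; have := kummer_coef_c1 a k c0; rewrite subrK => ->.
by field; rewrite c0 /=; have := c0 0%N; rewrite addr0.
Qed.

(** The operator [x d/dx] multiplies the [k]-th coefficient by [k]. *)
Lemma cvg_kummerX a c x : (forall k, c - 1 + k%:R != 0) ->
  pseries (fun k => (c - 1 + k%:R) * kummer_coef a c k) x @ \oo -->
  x * (a / c * kummerM (a + 1) (c + 1) x) + (c - 1) * kummerM a c x.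
Proof.
move=> c0; have c1 := shifted_neq0S c0; rewrite subrK in c1.
have H := cvg_pseriesD (cvg_pseriesX (@cvg_kummer_diffs a c x c1))
  (@cvg_pseriesZ (c - 1) _ _ _ (@cvg_kummer a c x c1)).
have -> : (fun k => (c - 1 + k%:R) * kummer_coef a c k) = (fun k =>
    (if k is j.+1 then pseries_diffs (kummer_coef a c) j else 0) + (c - 1) * kummer_coef a c k).
  by apply/funext => -[|k]; [rewrite add0r addr0|rewrite /pseries_diffs; ring].
exact: H.
Qed.

(** The left side is [x^(2-c) (x^(c-1) M)']. *)
Lemma kummer_derivX a c x : (forall k, c - 1 + k%:R != 0) ->
  x * (a / c * kummerM (a + 1) (c + 1) x) + (c - 1) * kummerM a c x =
  (c - 1) * kummerM a (c - 1) x.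
Proof.
move=> c0.
have r := @cvg_pseriesZ (c - 1) _ _ _ (@cvg_kummer a (c - 1) x c0).
apply: (cvg_pseries_eq (@cvg_kummerX a c x c0) r) => k.
by rewrite kummer_coef_cB.
Qed.

(** The left side is [x^(2-c) e^x (x^(c-1) e^-x M)']. *)
Lemma kummer_derivXB a c x : (forall k, c - 1 + k%:R != 0) ->
  x * (a / c * kummerM (a + 1) (c + 1) x) + ((c - 1) * kummerM a c x - x * kummerM a c x) =
  (c - 1) * kummerM (a - 1) (c - 1) x.
Proof.
move=> c0; have c1 := shifted_neq0S c0; rewrite subrK in c1.
rewrite addrA -(mulN1r (x * kummerM a c x)).
have L := cvg_pseriesD (@cvg_kummerX a c x c0)
  (@cvg_pseriesZ (-1) _ _ _ (cvg_pseriesX (@cvg_kummer a c x c1))).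
have r := @cvg_pseriesZ (c - 1) _ _ _ (@cvg_kummer (a - 1) (c - 1) x c0).
apply: (cvg_pseries_eq L r) => -[|k].
  by rewrite /kummer_coef !rfact0 mulr0 !addr0.
have := kummer_coef_cB (a - 1) k.+1 c0 => ->.
rewrite /kummer_coef [rfact (a - 1) _]rfactSl subrK !rfactS factS natrM natrS.
have cS : c + k%:R = c - 1 + (k%:R + 1) by ring.
have ck := c0 k.+1; rewrite natrS in ck; rewrite cS.
by field; rewrite fact_natr_neq0 ck rfact_neq0 //= -natrS pnatr_eq0.
Qed.

End Kummer.

(** * Seed functions *)

Section Weights.
Variable R : realType.
Implicit Types (u p b x y : R) (s e : bool) (k : nat).

(** The factors [phi], [1 / phi] and [psi] all have this shape, so that on positive arguments their
    products and powers reduce to [ring] on exponents. *)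
Definition wt u p (y : R) : R := expR (u * y) * xpow y p.

Lemma wtE u p y : 0 < y -> wt u p y = expR (u * y + p * ln y).
Proof. by move=> y0; rewrite /wt /xpow /powR gt_eqF // expRD. Qed.

Lemma wtD u p v q y : 0 < y -> wt u p y * wt v q y = wt (u + v) (p + q) y.
Proof. by move=> y0; rewrite !wtE // -expRD; congr expR; ring. Qed.

Lemma wt00 y : wt 0 0 y = 1.
Proof. by rewrite /wt mul0r expR0 /xpow powRr0 mulr1. Qed.

Lemma smooth_pos_wt u p : smooth_pos (wt u p).
Proof.
apply: smooth_posM.
- apply: (@smooth_pos_family _ unit (fun _ y => expR (u * y)) (fun=> u) id _ tt) => _ y _.
  have D : is_derive y 1 (fun z : R => u * z) (u * 1) by exact: (is_deriveZ u (is_derive_id y 1)).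
  apply: (is_derive_eq (is_derive1_comp (is_derive_expR (u * y)) D)).
  by rewrite mulr1 mulrC.
- apply: (@smooth_pos_family _ R (fun q y => xpow y q) id (fun q => q - 1) _ p) => q y y0.
Qed.

(** Kept apart from a general exponent [p]: when the powers of [x] cancel, no factor [x^-1] may
    appear, or the seeds would not share one [psi]. *)
Lemma is_derive_wt0M u (g : R -> R) y dg : 0 < y -> is_derive y 1 g dg ->
  is_derive y 1 (fun z => wt u 0 z * g z) (wt u 0 y * (u * g y + dg)).
Proof.
move=> y0 Dg.
have D : is_derive y 1 (fun z : R => u * z) (u * 1) by exact: (is_deriveZ u (is_derive_id y 1)).
have E := is_derive1_comp (is_derive_expR (u * y)) D.
have H := is_deriveM E Dg.
have Hw z : expR (u * z) * g z = wt u 0 z * g z by rewrite /wt /xpow powRr0 mulr1.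
apply: (is_derive_eqpos (fun z _ => Hw z) y0).
apply: (is_derive_eq H); rewrite /GRing.scale /= -/(wt u 0 y).
by rewrite /wt /xpow powRr0; ring.
Qed.

Lemma is_derive_wtM u p (g : R -> R) y dg : 0 < y -> is_derive y 1 g dg ->
  is_derive y 1 (fun z => wt u p z * g z)
    (wt u (p - 1) y * ((p + u * y) * g y + y * dg)).
Proof.
move=> y0 Dg.
have D : is_derive y 1 (fun z => xpow z p) (p * xpow y (p - 1)) by exact: is_derive1_powR.
have H := is_derive_wt0M u y0 (is_deriveM D Dg).
have Hw z : wt u 0 z * (xpow z p * g z) = wt u p z * g z.
  by rewrite /wt /xpow powRr0; ring.
apply: (is_derive_eqpos (fun z _ => Hw z) y0).
have Hm : ((fun z : R => xpow z p) * g) y = xpow y p * g y by [].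
apply: (is_derive_eq H); rewrite /GRing.scale /= Hm.
have -> : xpow y p = xpow y (p - 1) * y.
  rewrite /xpow -{3}(powRr1 (ltW y0)) -powRD ?subrK //.
  by rewrite (gt_eqF y0) implybT.
by rewrite /wt /xpow powRr0; ring.
Qed.

End Weights.

Section Seeds.
Variable R : realType.
Implicit Types (u p b lam x y : R) (s e : bool) (k : nat).

(* The four seed families: [s] records the factor [x^-b], [e] the factor [e^x]. *)
Definition seed b s e k : R -> R :=
  match s, e with
  | false, false => fun y => laguerre k b y
  | false, true => fun y => expR y * laguerre k b (- y)
  | true, false => fun y => xpow y (- b) * laguerre k (- b) y
  | true, true => fun y => expR y * xpow y (- b) * laguerre k (- b) (- y)
  end.

Definition seed_poly b s e k y : R :=
  (laguerre_poly k (if s then - b else b)).[if e then - y else y].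

Lemma seedE b s e k y :
  seed b s e k y = wt e%:R (if s then - b else 0) y * seed_poly b s e k y.
Proof.
by rewrite /wt /xpow /seed /seed_poly; case: s e => [] [];
  rewrite ?powRr0 ?mul0r ?mul1r ?expR0 ?mulr1 ?mul1r laguerreE.
Qed.

Lemma is_derive_horner (p : {poly R}) y : is_derive y 1 (horner p) (p^`()).[y].
Proof. by rewrite derivE; apply: derivable_is_derive1; exact: derivable_horner. Qed.

Lemma is_derive_seed_poly b s e k y :
  is_derive y 1 (seed_poly b s e k)
    ((if e then -1 else 1) * (laguerre_poly k (if s then - b else b))^`().[if e then - y else y]).
Proof.
rewrite /seed_poly; case: e; last by rewrite mul1r; exact: is_derive_horner.
have N : is_derive y 1 (fun z : R => - z) (-1) by exact: (is_deriveN (is_derive_id y 1)).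
by apply: (is_derive_eq (is_derive1_comp (is_derive_horner _ (- y)) N)); rewrite mulrC.
Qed.

Lemma smooth_pos_seed b s e k : smooth_pos (seed b s e k).
Proof.
apply: (@smooth_pos_eq _ (fun y => wt e%:R (if s then - b else 0) y * seed_poly b s e k y)).
  by move=> y _; rewrite seedE.
apply: smooth_posM; first exact: smooth_pos_wt.
pose F (p : {poly R}) (y : R) := p.[if e then - y else y].
apply: (@smooth_pos_family _ _ F (fun=> if e then -1 else 1) deriv) => p y _.
rewrite /F; case: e {F}; last by rewrite mul1r; exact: is_derive_horner.
have N : is_derive y 1 (fun z : R => - z) (-1) by exact: (is_deriveN (is_derive_id y 1)).
by apply: (is_derive_eq (is_derive1_comp (is_derive_horner _ (- y)) N)); rewrite mulrC.
Qed.

Definition step_b (s0 : bool) b : R := if s0 then b - 1 else b + 1.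

Definition step_psi (s0 e0 : bool) b : R -> R := wt (- e0%:R) (if s0 then b - 1 else 0).

Definition step_phiV (s0 e0 : bool) b : R -> R := wt (- e0%:R) (if s0 then b else 0).

Definition step_c (s0 e0 : bool) b s e k : R :=
  if s == s0 then (if e then 1 else -1)
  else if e == e0 then k%:R + (if s then - b else b) else k%:R + 1.

Definition bump_if (c : bool) k : nat := if c then k.+1 else k.

(** For [s = s0] the powers of [x] cancel and the relation is [deriv_laguerre] or [deriv_laguerreB],
    according to whether the exponentials cancel too; for [s <> s0] it is [deriv_laguerreX] or
    [deriv_laguerreXB]. The degree falls for the removed kind and rises for the opposite one, hence
    the two [bump_if]. *)
Lemma is_derive_seed_step s0 e0 b s e k y : 0 < y ->
  is_derive y 1
    (fun z => step_phiV s0 e0 b z * seed b s e (bump_if ((s == s0) && (e == e0)) k) z)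
    (step_psi s0 e0 b y *
     (step_c s0 e0 b s e k *
      seed (step_b s0 b) s e (bump_if ((s == ~~ s0) && (e == ~~ e0)) k) y)).
Proof.
move=> y0; set k1 := bump_if _ k; set k2 := bump_if _ k.
have E : eqpos (fun z => wt (- e0%:R + e%:R)
      ((if s0 then b else 0) + (if s then - b else 0)) z * seed_poly b s e k1 z)
    (fun z => step_phiV s0 e0 b z * seed b s e k1 z).
  by move=> z z0; rewrite seedE mulrA /step_phiV wtD.
apply: (is_derive_eqpos E y0).
have Dg := is_derive_seed_poly b s e k1 y.
have EA (n : nat) (a z : R) : (laguerre_poly n.+1 a)^`().[z] = - (laguerre_poly n (a + 1)).[z].
  by rewrite deriv_laguerre hornerN.
have EB (n : nat) (a z : R) : (laguerre_poly n a)^`().[z] =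
    (laguerre_poly n a).[z] - (laguerre_poly n (a + 1)).[z].
  by rewrite -hornerN -deriv_laguerreB hornerD hornerN addrC subrK.
have EC (n : nat) (a z : R) : z * (laguerre_poly n a)^`().[z] =
    (n%:R + a) * (laguerre_poly n (a - 1)).[z] - a * (laguerre_poly n a).[z].
  have /(congr1 (fun p : {poly R} => p.[z])) := deriv_laguerreX n a.
  by rewrite hornerD hornerM hornerX !hornerZ => <-; rewrite addrK.
have ED (n : nat) (a z : R) : z * (laguerre_poly n a)^`().[z] =
    (n%:R + 1) * (laguerre_poly n.+1 (a - 1)).[z]
    - (a * (laguerre_poly n a).[z] - z * (laguerre_poly n a).[z]).
  have /(congr1 (fun p : {poly R} => p.[z])) := deriv_laguerreXB n a.
  rewrite hornerD hornerM hornerX hornerD hornerN !hornerZ hornerM hornerX natrS => <-.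
  by rewrite addrK.
have reord (p q u v : R) : p * (q * (u * v)) = (p * u) * (q * v) by ring.
have E1 : - (b + 1) = - b - 1 by ring.
have E2 : - (b - 1) = - b + 1 by ring.
have ECN (n : nat) (a z : R) : - (z * (laguerre_poly n a)^`().[- z]) =
    (n%:R + a) * (laguerre_poly n (a - 1)).[- z] - a * (laguerre_poly n a).[- z].
  by rewrite -EC; ring.
have EDN (n : nat) (a z : R) : - (z * (laguerre_poly n a)^`().[- z]) =
    (n%:R + 1) * (laguerre_poly n.+1 (a - 1)).[- z]
    - (a * (laguerre_poly n a).[- z] + z * (laguerre_poly n a).[- z]).
  by have := ED n a (- z); rewrite !mulNr opprK.
have [ss|ss] := eqVneq s s0.
  have p0 : (if s0 then b else 0) + (if s then - b else 0) = 0.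
    by rewrite ss; case: (s0); ring.
  rewrite p0; apply: (is_derive_eq (is_derive_wt0M _ y0 Dg)).
  rewrite seedE /step_psi reord wtD //.
  have -> : (if s0 then b - 1 else 0) +
      (if s then - step_b s0 b else 0) = 0.
    by rewrite ss /step_b; case: (s0); ring.
  congr (_ * _); rewrite /step_c ss eqxx /k1 /k2 /seed_poly ss eqxx /step_b /=.
  have -> : (s0 == ~~ s0) = false by case: (s0).
  case: (s0) (e) (e0) => [] [] [] /=; rewrite ?E2 ?EA ?EB; ring.
have p0 : (if s0 then b else 0) + (if s then - b else 0) = (if s then - b else b).
  by move: ss; case: (s) (s0) => [] [] //= _; ring.
rewrite p0; apply: (is_derive_eq (is_derive_wtM _ _ y0 Dg)).
rewrite seedE /step_psi reord wtD //.
have -> : (if s0 then b - 1 else 0) +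
      (if s then - step_b s0 b else 0) = (if s then - b else b) - 1.
  by move: ss; rewrite /step_b; case: (s) (s0) => [] [] //= _; ring.
congr (_ * _); rewrite /step_c (negbTE ss) /k1 /k2 /seed_poly /step_b /=.
have EyN z : y * (-1 * z) = - (y * z) by ring.
(* [EC] and [ED] rewrite the same derivative: the first alternative closes the goals with [e = e0],
   the second those with [e <> e0]. *)
move: ss {p0 E Dg k1 k2}; case: s s0 => [] [] //= _; case: e e0 => [] [] /=;
  rewrite ?E1 ?EyN ?mul1r; (rewrite ?ECN ?EC; ring) || (rewrite ?EDN ?ED; ring).
Qed.

End Seeds.

(** * One-step relations for Omega *)

Section KummerSeed.
Variable R : realType.
Implicit Types (b lam x y : R) (s e : bool) (k : nat).

Lemma smooth_pos_htilde b lam : (forall k, 1 - b + k%:R != 0) -> smooth_pos (htilde b lam).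
Proof.
move=> b0; apply: smooth_posM.
  apply: (@smooth_pos_family _ R (fun q y => xpow y q) id (fun q => q - 1)) => q y y0.
pose F (j : nat) := kummerM (- lam - b + j%:R) (1 - b + j%:R).
have -> : kummerM (- lam - b) (1 - b) = F 0%N by rewrite /F !addr0.
apply: (@smooth_pos_family _ _ F
  (fun j => (- lam - b + j%:R) / (1 - b + j%:R)) S) => j y _.
rewrite /F !natrS !addrA; apply: is_derive_kummer => k.
by rewrite -addrA -natrD.
Qed.

(** By Kummer's transformation [htilde] is, up to normalisation, a seed with both factors [e^x] and
    [x^-b] and degree [- lam - 1]. So [lam] moves only if the removed kind is that one or its
    opposite. *)
Definition step_lam (s0 e0 : bool) lam : R :=
  if s0 == e0 then (if s0 then lam + 1 else lam - 1) else lam.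

(** With [a = - lam - b] and [c = 1 - b] the three values are [(a - c) / c], [a / c] and [c - 1], as
    in the contiguous relations. *)
Definition step_ch (s0 e0 : bool) b lam : R :=
  if s0 then (if e0 then - (lam + 1) / (1 - b) else (- lam - b) / (1 - b)) else - b.

Lemma is_derive_htilde_step s0 e0 b lam y : 0 < y ->
  (forall k, 1 - b + k%:R != 0) -> (forall k, 1 - step_b s0 b + k%:R != 0) ->
  is_derive y 1 (fun z => step_phiV s0 e0 b z * htilde b lam z)
    (step_psi s0 e0 b y *
     (step_ch s0 e0 b lam * htilde (step_b s0 b) (step_lam s0 e0 lam) y)).
Proof.
move=> y0 b0 b1; set K := kummerM (- lam - b) (1 - b).
have wh c l z : htilde c l z = wt 0 (- c) z * kummerM (- l - c) (1 - c) z.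
  by rewrite /wt mul0r expR0 mul1r.
have E : eqpos (fun z => wt (- e0%:R + 0) ((if s0 then b else 0) + - b) z * K z)
    (fun z => step_phiV s0 e0 b z * htilde b lam z).
  by move=> z z0; rewrite wh mulrA /step_phiV wtD //.
apply: (is_derive_eqpos E y0).
have Dg := is_derive_kummer (- lam - b) y b0.
set K' := _ * kummerM _ _ y in Dg.
have relB : K' = K y + (- lam - b - (1 - b)) / (1 - b) * kummerM (- lam - b) (1 - b + 1) y.
  by rewrite -kummer_derivB // addrC subrK.
have reord (p q u v : R) : p * (q * (u * v)) = (p * u) * (q * v) by ring.
rewrite wh /step_psi reord (wtD _ _ _ _ y0) addr0.
case: s0 b1 {E} => b1; rewrite /step_b in b1 *.
  rewrite subrr; apply: (is_derive_eq (is_derive_wt0M _ y0 Dg)).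
  rewrite subrr; congr (_ * _).
  have -> : 1 - (b - 1) = 1 - b + 1 by ring.
  rewrite /step_lam /step_ch; case: e0 => /=; rewrite ?(mulr1n, mulr0n).
    have -> : - (lam + 1) - (b - 1) = - lam - b by ring.
    by rewrite relB -/K; ring.
  have -> : - lam - (b - 1) = - lam - b + 1 by ring.
  by rewrite /K' -/K; ring.
rewrite add0r; apply: (is_derive_eq (is_derive_wtM _ _ y0 Dg)).
have E1 : 1 - (b + 1) = 1 - b - 1 by ring.
have b2 k : 1 - b - 1 + k%:R != 0 by rewrite -E1; exact: b1.
rewrite add0r E1 opprD; congr (_ * _).
rewrite /step_lam /step_ch /= -/K.
have cb : - b = 1 - b - 1 by ring.
case: e0 => /=; rewrite ?(mulr1n, mulr0n).
  have H := kummer_derivXB (- lam - b) y b2; rewrite -/K' -/K in H.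
  have -> : - lam + (- b - 1) = - lam - b - 1 by ring.
  by rewrite [X in _ = X * _]cb -H; ring.
have H := kummer_derivX (- lam - b) y b2; rewrite -/K' -/K in H.
have -> : - (lam - 1) + (- b - 1) = - lam - b by ring.
by rewrite [X in _ = X * _]cb -H; ring.
Qed.

End KummerSeed.

Section OmegaSteps.
Variable R : realType.
Implicit Types (b lam x y : R) (n q m : seq nat).

Definition pm (s : R) : Prop := s = 1 \/ s = -1.

Lemma pmM (s t : R) : pm s -> pm t -> pm (s * t).
Proof. by move=> [->|->] [->|->]; rewrite /pm ?mulrNN ?mulr1 ?mul1r; auto. Qed.

Lemma pm_sqr (s : R) : pm s -> s * s = 1.
Proof. by move=> [->|->]; rewrite ?mulrNN mulr1. Qed.

Lemma pmX (s : R) k : pm s -> pm (s ^+ k).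
Proof. by move=> ps; elim: k => [|k IH]; [left|rewrite exprS; exact: pmM]. Qed.

Lemma big_const_pm (s : R) (l : seq nat) : pm s -> pm (\prod_(k <- l) s).
Proof. by move=> ps; rewrite big_const_seq iter_mulr_1; exact: pmX. Qed.

(* [None] stands for the last entry [h] of the Wronskian. *)
Definition fam b (h : R -> R) (t : option (bool * bool * nat)) : R -> R :=
  if t is Some (s, e, k) then seed b s e k else h.

Definition idx n q m m' : seq (option (bool * bool * nat)) :=
  [seq Some (false, false, k) | k <- n] ++ [seq Some (false, true, k) | k <- m] ++
  [seq Some (true, false, k) | k <- m'] ++ [seq Some (true, true, k) | k <- q] ++ [:: None].

Lemma size_idx n q m m' :
  size (idx n q m m') = (size n + (size m + (size m' + (size q + 1))))%N.
Proof. by rewrite !size_cat !size_map. Qed.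

Lemma OmegaE n q m m' b h x :
  Omega (Maya q n) (Maya m' m) b h x =
  expR (- ((size m + size q)%:R * x))
  * xpow x ((b + (size n + size m)%:R) * (size m' + size q).+1%:R)
  * wronskian (map (fam b h) (idx n q m m')) x.
Proof. by rewrite /idx !map_cat -!map_comp. Qed.

(* Both sides of a step are indexed by the same list: the seed [(s, e, k)] stands
   for degree [k.+1] before the step if it is of the removed kind [(s0, e0)], and
   for degree [k.+1] after the step if it is of the opposite kind. *)
Definition fam_old (s0 e0 : bool) b h (t : option (bool * bool * nat)) : R -> R :=
  if t is Some (s, e, k) then seed b s e (bump_if ((s == s0) && (e == e0)) k) else h.

Definition fam_new (s0 e0 : bool) b h (t : option (bool * bool * nat)) : R -> R :=
  if t is Some (s, e, k)
  then seed (step_b s0 b) s e (bump_if ((s == ~~ s0) && (e == ~~ e0)) k) else h.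

Definition fam_c (s0 e0 : bool) b (ch : R) (t : option (bool * bool * nat)) : R :=
  if t is Some (s, e, k) then step_c s0 e0 b s e k else ch.

(** The weight is [phi^(N+1) psi^N], with [N] the number of remaining functions: all exponentials
    but one cancel, and for [s0] the power of [x] is [- b (N+1) + (b-1) N = - (b + N)]. *)
Lemma Omega_reduce s0 e0 b lam n q m m' s1 s2 l :
  (forall k, 1 - b + k%:R != 0) -> (forall k, 1 - step_b s0 b + k%:R != 0) ->
  map (fam b (htilde b lam)) l =
    map (fam_old s0 e0 b (htilde b lam)) s1 ++ seed b s0 e0 0 ::
    map (fam_old s0 e0 b (htilde b lam)) s2 ->
  s1 ++ s2 = idx n q m m' ->
  exists2 s, pm s & forall x, 0 < x ->
    wronskian (map (fam b (htilde b lam)) l) x =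
    s * wt e0%:R (if s0 then - (b + (size (idx n q m m'))%:R) else 0) x *
    (\prod_(t <- idx n q m m') fam_c s0 e0 b (step_ch s0 e0 b lam) t) *
    wronskian (map (fam_new s0 e0 b (htilde (step_b s0 b) (step_lam s0 e0 lam)))
      (idx n q m m')) x.
Proof.
move=> b0 b1 -> E; exists ((-1) ^+ size s1); first by apply: pmX; right.
have sphi : smooth_pos (seed b s0 e0 0) by exact: smooth_pos_seed.
have sphiV : smooth_pos (step_phiV s0 e0 b) by exact: smooth_pos_wt.
have spsi : smooth_pos (step_psi s0 e0 b) by exact: smooth_pos_wt.
have phiK : eqpos (fun y => seed b s0 e0 0 y * step_phiV s0 e0 b y) (fun=> 1).
  move=> y y0; rewrite seedE /seed_poly laguerre_poly0 hornerC mulr1 /step_phiV wtD //.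
  by rewrite subrr; case: (s0); rewrite ?addNr ?addr0 wt00.
have sF t : smooth_pos (fam_old s0 e0 b (htilde b lam) t).
  by case: t => [[[s e] k]|]; [exact: smooth_pos_seed|exact: smooth_pos_htilde].
have sG t : smooth_pos (fam_new s0 e0 b (htilde (step_b s0 b) (step_lam s0 e0 lam)) t).
  by case: t => [[[s e] k]|]; [exact: smooth_pos_seed|exact: smooth_pos_htilde].
have dF t (y : R) : 0 < y ->
    is_derive y 1 (fun z => step_phiV s0 e0 b z * fam_old s0 e0 b (htilde b lam) t z)
      (step_psi s0 e0 b y * (fam_c s0 e0 b (step_ch s0 e0 b lam) t *
       fam_new s0 e0 b (htilde (step_b s0 b) (step_lam s0 e0 lam)) t y)).
  by move=> y0; case: t => [[[s e] k]|]; [exact: is_derive_seed_step|exact: is_derive_htilde_step].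
move=> x x0; rewrite (wronskian_reduce s1 s2 x0 sphi sphiV spsi phiK sF sG dF).
rewrite -size_cat E; congr (_ * _ * _); rewrite -!mulrA; congr (_ * _).
rewrite seedE /seed_poly laguerre_poly0 hornerC mulr1 /step_psi !wtE //.
rewrite -!expRM_natl -expRD; congr expR; rewrite natrS.
by case: (s0); ring.
Qed.

Lemma prod_idx (c : option (bool * bool * nat) -> R) n q m m' :
  \prod_(t <- idx n q m m') c t =
  (\prod_(k <- n) c (Some (false, false, k))) * (\prod_(k <- m) c (Some (false, true, k))) *
  (\prod_(k <- m') c (Some (true, false, k))) * (\prod_(k <- q) c (Some (true, true, k))) *
  c None.
Proof. by rewrite /idx !big_cat !big_map big_seq1 /= !mulrA. Qed.

Lemma prefactorE (u p u' p' u'' p'' x : R) : 0 < x ->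
  u + u' = u'' -> p + p' = p'' ->
  expR (u * x) * xpow x p * wt u' p' x = expR (u'' * x) * xpow x p''.
Proof. by move=> x0 <- <-; rewrite -!/(wt _ _ _) wtD. Qed.

(** Elements of the first diagram are of the removed kind and its holes of the opposite kind, so the
    step translates it by -1. The seeds of the second diagram keep their degrees and only contribute
    constants. *)
Lemma Omega_down1_0 n q m m' b lam :
  (forall k, 1 - b + k%:R != 0) -> (forall k, 1 - (b + 1) + k%:R != 0) ->
  exists2 s, pm s & forall x, 0 < x ->
    Omega (Maya q (rcons (map succn n) 0)) (Maya m' m) b (htilde b lam) x =
    s * ((\prod_(k <- m') (k%:R - b)) * (\prod_(k <- q) (k%:R + 1)) * - b) *
    Omega (Maya (map succn q) n) (Maya m' m) (b + 1) (htilde (b + 1) (lam - 1)) x.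
Proof.
move=> b0 b1.
have [] := @Omega_reduce false false b lam n q m m' [seq Some (false, false, k) | k <- n]
  ([seq Some (false, true, k) | k <- m] ++ [seq Some (true, false, k) | k <- m'] ++
   [seq Some (true, true, k) | k <- q] ++ [:: None])
  (idx (rcons (map succn n) 0) q m m') b0 b1 _ erefl.
  by rewrite /idx !map_cat -!map_comp map_rcons cat_rcons -map_comp.
move=> s ps H; exists (s * ((\prod_(k <- n) -1) * (\prod_(k <- m) 1))).
  by apply: pmM ps _; apply: pmM; apply: big_const_pm; [right|left].
move=> x x0; rewrite !OmegaE H // prod_idx /= /step_c /=.
have -> : map (fam_new false false b (htilde (b + 1) (lam - 1))) (idx n q m m') =
  map (fam (b + 1) (htilde (b + 1) (lam - 1))) (idx n (map succn q) m m').
  by rewrite /idx !map_cat -!map_comp.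
rewrite wt00 size_rcons !size_map -!mulNr.
have -> : b + ((size n).+1 + size m)%:R = b + 1 + (size n + size m)%:R.
  by rewrite addSn natrS; ring.
by rewrite /step_ch; ring.
Qed.

Lemma Omega_down2_0 n q m m' b lam :
  (forall k, 1 - b + k%:R != 0) -> (forall k, 1 - (b + 1) + k%:R != 0) ->
  exists2 s, pm s & forall x, 0 < x ->
    Omega (Maya q n) (Maya m' (rcons (map succn m) 0)) b (htilde b lam) x =
    s * ((\prod_(k <- q) (k%:R - b)) * (\prod_(k <- m') (k%:R + 1)) * - b) *
    Omega (Maya q n) (Maya (map succn m') m) (b + 1) (htilde (b + 1) lam) x.
Proof.
move=> b0 b1.
have [] := @Omega_reduce false true b lam n q m m'
  ([seq Some (false, false, k) | k <- n] ++ [seq Some (false, true, k) | k <- m])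
  ([seq Some (true, false, k) | k <- m'] ++
   [seq Some (true, true, k) | k <- q] ++ [:: None])
  (idx n q (rcons (map succn m) 0) m') b0 b1 _ _.
- by rewrite /idx !map_cat -!map_comp map_rcons cat_rcons -map_comp -catA.
- by rewrite -catA.
move=> s ps H; exists (s * ((\prod_(k <- n) -1) * (\prod_(k <- m) 1))).
  by apply: pmM ps _; apply: pmM; apply: big_const_pm; [right|left].
move=> x x0; rewrite !OmegaE H // prod_idx /= /step_c /=.
have -> : map (fam_new false true b (htilde (b + 1) lam)) (idx n q m m') =
  map (fam (b + 1) (htilde (b + 1) lam)) (idx n q m (map succn m')).
  by rewrite /idx !map_cat -!map_comp.
rewrite size_rcons !size_map -!mulNr.
(* The factor [e^x] left by the reduction compensates the drop of [r2] in the prefactor; the power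
   of [x] does not change. *)
rewrite -[in RHS](@prefactorE (- ((size m).+1 + size q)%:R)
  ((b + (size n + (size m).+1)%:R) * (size m' + size q).+1%:R) 1 0
  (- (size m + size q)%:R) ((b + 1 + (size n + size m)%:R) * (size m' + size q).+1%:R)) //.
- by rewrite /step_ch; ring.
- by rewrite addSn natrS; ring.
- by rewrite addnS natrS; ring.
Qed.

Lemma Omega_up2 n q m m' b lam :
  (forall k, 1 - b + k%:R != 0) -> (forall k, 1 - (b - 1) + k%:R != 0) ->
  exists2 s, pm s & forall x, 0 < x ->
    Omega (Maya q n) (Maya (rcons (map succn m') 0) m) b (htilde b lam) x =
    s * ((\prod_(k <- n) (k%:R + b)) * (\prod_(k <- m) (k%:R + 1)) *
         ((- lam - b) / (1 - b))) *
    Omega (Maya q n) (Maya m' (map succn m)) (b - 1) (htilde (b - 1) lam) x.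
Proof.
move=> b0 b1.
have [] := @Omega_reduce true false b lam n q m m'
  ([seq Some (false, false, k) | k <- n] ++ [seq Some (false, true, k) | k <- m] ++
   [seq Some (true, false, k) | k <- m'])
  ([seq Some (true, true, k) | k <- q] ++ [:: None])
  (idx n q m (rcons (map succn m') 0)) b0 b1 _ _.
- by rewrite /idx !map_cat -!map_comp map_rcons cat_rcons -map_comp -!catA.
- by rewrite -!catA.
move=> s ps H; exists (s * ((\prod_(k <- m') -1) * (\prod_(k <- q) 1))).
  by apply: pmM ps _; apply: pmM; apply: big_const_pm; [right|left].
move=> x x0; rewrite !OmegaE H // prod_idx /= /step_c /=.
have -> : map (fam_new true false b (htilde (b - 1) lam)) (idx n q m m') =
  map (fam (b - 1) (htilde (b - 1) lam)) (idx n q (map succn m) m').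
  by rewrite /idx !map_cat -!map_comp.
rewrite size_idx size_rcons !size_map -!mulNr.
(* With [B = b + r1 + r2] and [S = r3 + r4 + 1] after removal of the seed, the power of [x] is
   [B (S+1) - (B + S) = (B-1) S], which is where the exponent in [Omega] comes from. *)
rewrite -[in RHS](@prefactorE (- (size m + size q)%:R)
  ((b + (size n + size m)%:R) * ((size m').+1 + size q).+1%:R) 0
  (- (b + (size n + (size m + (size m' + (size q + 1))))%:R))
  (- (size m + size q)%:R) ((b - 1 + (size n + size m)%:R) * (size m' + size q).+1%:R)) //.
- by rewrite /step_ch; ring.
- by rewrite addr0.
- by rewrite !addSn !natrS !natrD; ring.
Qed.

Lemma Omega_up1 n q m m' b lam :
  (forall k, 1 - b + k%:R != 0) -> (forall k, 1 - (b - 1) + k%:R != 0) ->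
  exists2 s, pm s & forall x, 0 < x ->
    Omega (Maya (rcons (map succn q) 0) n) (Maya m' m) b (htilde b lam) x =
    s * ((\prod_(k <- m) (k%:R + b)) * (\prod_(k <- n) (k%:R + 1)) *
         ((lam + 1) / (1 - b))) *
    Omega (Maya q (map succn n)) (Maya m' m) (b - 1) (htilde (b - 1) (lam + 1)) x.
Proof.
move=> b0 b1.
have [] := @Omega_reduce true true b lam n q m m'
  ([seq Some (false, false, k) | k <- n] ++ [seq Some (false, true, k) | k <- m] ++
   [seq Some (true, false, k) | k <- m'] ++ [seq Some (true, true, k) | k <- q])
  [:: None]
  (idx n (rcons (map succn q) 0) m m') b0 b1 _ _.
- by rewrite /idx !map_cat -!map_comp map_rcons cat_rcons -map_comp -!catA.
- by rewrite -!catA.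
(* The last sign comes from [step_ch], which is [- (lam + 1) / (1 - b)] here. *)
move=> s ps H; exists (s * ((\prod_(k <- m') -1) * (\prod_(k <- q) 1)) * -1).
  apply: pmM; last by right.
  by apply: pmM ps _; apply: pmM; apply: big_const_pm; [right|left].
move=> x x0; rewrite !OmegaE H // prod_idx /= /step_c /=.
have -> : map (fam_new true true b (htilde (b - 1) (lam + 1))) (idx n q m m') =
  map (fam (b - 1) (htilde (b - 1) (lam + 1))) (idx (map succn n) q m m').
  by rewrite /idx !map_cat -!map_comp.
rewrite size_idx size_rcons !size_map -!mulNr.
rewrite -[in RHS](@prefactorE (- (size m + (size q).+1)%:R)
  ((b + (size n + size m)%:R) * (size m' + (size q).+1).+1%:R) 1
  (- (b + (size n + (size m + (size m' + (size q + 1))))%:R))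
  (- (size m + size q)%:R) ((b - 1 + (size n + size m)%:R) * (size m' + size q).+1%:R)) //.
- by rewrite /step_ch; ring.
- by rewrite addnS natrS; ring.
- by rewrite !addnS !natrS !natrD; ring.
Qed.

End OmegaSteps.

(** * Maya diagrams *)

Lemma maya_eqP (M N : maya) : maya_wf M -> maya_wf N ->
  maya_mem M =1 maya_mem N -> M = N.
Proof.
case: M N => [p n] [q m] [/= sp sn] [/= sq sm] E.
have irr : irreflexive gtn by move=> i; rewrite /= ltnn.
have trg : transitive gtn by move=> i j k /= ij jk; exact: ltn_trans jk ij.
congr Maya; apply: (irr_sorted_eq trg irr) => // i.
- have := E (- (i%:Z) - 1); rewrite /maya_mem /=.
  have -> : 0 <= - i%:Z - 1 = false by lia.
  have -> : (`|- i%:Z - 1|%N).-1 = i by lia.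
  by move/negb_inj ->.
- by have := E i%:Z; rewrite /maya_mem /=.
Qed.

Lemma gtn_sorted_filter (p : pred nat) N : sorted gtn (rev [seq j <- iota 0 N | p j]).
Proof. by rewrite rev_sorted; apply: sorted_filter (iota_ltn_sorted _ _); exact: ltn_trans. Qed.

Lemma maya_shift_wf M t : maya_wf (maya_shift M t).
Proof. by split; exact: gtn_sorted_filter. Qed.

Lemma leq_foldr_maxn (s : seq nat) i : i \in s -> (i <= foldr maxn 0 s)%N.
Proof.
elim: s => //= a s IH; rewrite inE leq_max => /orP[/eqP ->|/IH ->]; first by rewrite leqnn.
by rewrite orbT.
Qed.

(** The bound [N] exceeds every listed degree by more than the shift, so past it membership takes
    its default value on both sides. *)
Lemma maya_mem_shift M t k : maya_mem (maya_shift M t) k = maya_mem M (k - t).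
Proof.
rewrite {1}/maya_mem /maya_shift /=; set N := (_ + 1)%N.
case: ifP => k0; rewrite mem_rev mem_filter mem_iota add0n /=.
  rewrite gez0_abs //; case: ltnP => [_|Nk]; first by rewrite andbT.
  rewrite andbF /maya_mem; case: ifP => [_|]; last by lia.
  by apply/esym/negbTE/negP => /leq_foldr_maxn; lia.
have -> : - ((`|k|%N).-1%:Z) - 1 = k by lia.
rewrite negb_and negbK; case: ltnP => [_|Nk]; first by rewrite orbF.
rewrite orbT /maya_mem; case: ifP => [|_]; first by lia.
by apply/esym/negP => /leq_foldr_maxn; lia.
Qed.

Lemma maya_shift0 M : maya_wf M -> maya_shift M 0 = M.
Proof.
move=> wM; apply: maya_eqP => //; first exact: maya_shift_wf.
by move=> k; rewrite maya_mem_shift subr0.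
Qed.

Lemma maya_shift_step M N s t : maya_wf M -> maya_wf N ->
  (forall k, maya_mem N k = maya_mem M (k - s)) ->
  maya_shift N (t - s) = maya_shift M t.
Proof.
move=> wM wN E; apply: maya_eqP; try exact: maya_shift_wf.
by move=> k; rewrite !maya_mem_shift E; congr maya_mem; lia.
Qed.

Lemma sorted_gtn_map_succn (s : seq nat) : sorted gtn (map succn s) = sorted gtn s.
Proof. by rewrite sorted_map. Qed.

Lemma sorted_gtn_rcons0 (s : seq nat) : sorted gtn s -> sorted gtn (rcons (map succn s) 0).
Proof.
case: s => //= a s; rewrite rcons_path path_map => ->.
by rewrite last_map.
Qed.

(** In a strictly decreasing list 0 can only come last, and every other entry is a successor. *)
Lemma sorted_gtn_split (s : seq nat) : sorted gtn s ->
  exists2 q, sorted gtn q & s = if 0%N \in s then rcons (map succn q) 0 else map succn q.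
Proof.
elim: s => [|a s IH]; first by exists [::].
move=> /= pas; have [q sq Es] := IH (path_sorted pas).
have trg : transitive gtn by move=> i j k /= ij jk; exact: ltn_trans jk ij.
have la i : i \in s -> (i < a)%N by move/(order_path_min trg): pas => /allP H /H.
case: a pas la => [|a] pas la.
  have -> : s = [::] by case: s {IH Es pas} la => // i s /(_ i); rewrite inE eqxx => /(_ isT).
  by exists [::].
have saq : sorted gtn (a :: q).
  by move: Es pas; case: ifP => _ ->; rewrite /= ?rcons_path path_map // => /andP[].
exists (a :: q) => //; rewrite inE /= {1}Es.
by case: ifP => _; rewrite ?rcons_cons.
Qed.

Lemma mem_map_succn (s : seq nat) i : (i \in map succn s) = (0 < i)%N && (i.-1 \in s).
Proof.
case: i => [|i] /=; first by apply/negbTE/mapP => -[].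
by rewrite mem_map //; exact: succn_inj.
Qed.

(** Only [k = -1] mixes the two lists: the element 0 before the translation becomes the absence of
    the hole 0 after it. *)
Lemma maya_mem_down0 q n k :
  maya_mem (Maya (map succn q) n) k = maya_mem (Maya q (rcons (map succn n) 0)) (k + 1).
Proof.
rewrite /maya_mem /=; case: (ltrgt0P (k + 1)) => hk.
- have -> : (0 <= k)%R = true by lia.
  rewrite mem_rcons inE mem_map_succn.
  have -> : `|(k + 1)%R|%N = (`|k|%N).+1 by lia.
  by [].
- have -> : (0 <= k)%R = false by lia.
  rewrite mem_map_succn; have -> : (`|k|%N).-1 = ((`|(k + 1)%R|%N).-1).+1 by lia.
  by [].
- have -> : k = -1 by lia.
  by rewrite /= mem_map_succn mem_rcons inE eqxx.
Qed.

Lemma maya_mem_down q n k :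
  maya_mem (Maya (rcons (map succn q) 0) n) k = maya_mem (Maya q (map succn n)) (k + 1).
Proof.
rewrite /maya_mem /=; case: (ltrgt0P (k + 1)) => hk.
- have -> : (0 <= k)%R = true by lia.
  rewrite mem_map_succn.
  have -> : `|(k + 1)%R|%N = (`|k|%N).+1 by lia.
  by [].
- have -> : (0 <= k)%R = false by lia.
  rewrite mem_rcons inE mem_map_succn; have -> : (`|k|%N).-1 = ((`|(k + 1)%R|%N).-1).+1 by lia.
  by [].
- have -> : k = -1 by lia.
  by rewrite /= mem_map_succn mem_rcons inE eqxx.
Qed.

Lemma mex_succ q : mex (map succn q) = 0%N.
Proof. by rewrite /mex /= mem_map_succn. Qed.

Lemma mex_rcons0 q : mex (rcons (map succn q) 0) = (mex q).+1.
Proof.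
have H L : find (fun j => j \notin rcons (map succn q) 0) (0%N :: map succn L) =
    (find (fun j => j \notin q) L).+1.
  rewrite /= mem_rcons inE eqxx /= find_map; congr _.+1.
  by apply: eq_find => i /=; rewrite mem_rcons inE mem_map_succn.
by rewrite /mex size_rcons size_map -H -(iotaDl 1 0).
Qed.

Lemma mex_gt0 s : (0 < mex s)%N -> 0%N \in s.
Proof. by rewrite /mex /=; case: (0%N \in s). Qed.

Lemma tprime_down0 q n : sorted gtn n ->
  tprime (Maya (map succn q) n) = tprime (Maya q (rcons (map succn n) 0)) + 1.
Proof.
rewrite /tprime /maya_max /=; case: n => [|a n] _ /=; last by lia.
by rewrite mex_succ; lia.
Qed.

Lemma tprime_down q n : n != [::] ->
  tprime (Maya (rcons (map succn q) 0) n) = tprime (Maya q (map succn n)) + 1.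
Proof. by rewrite /tprime /maya_max /=; case: n => //= a n _; lia. Qed.

Lemma tprime_up q : tprime (Maya q [::]) = tprime (Maya (rcons (map succn q) 0) [::]) - 1.
Proof. by rewrite /tprime /maya_max /= mex_rcons0; lia. Qed.

Lemma tprime_ge0 M : 0 <= tprime M -> mpos M = [::].
Proof. by rewrite /tprime /maya_max; case: (mpos M) => // a s; lia. Qed.

Lemma tprime_mpos M n : maya_wf M -> n \in mpos M -> tprime M <= - n%:Z - 1.
Proof.
case: M => q s [_ /= ss]; rewrite /tprime /maya_max /=; case: s ss => // a s /= pas.
have trg : transitive gtn by move=> i j k /= ij jk; exact: ltn_trans jk ij.
have /allP la := order_path_min trg pas.
by rewrite inE => /orP[/eqP ->|/la /=]; lia.
Qed.

(** * The constants D1, D2, D3 *)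

Section Constants.
Variable R : realType.
Implicit Types (b lam u v a w : R) (n q m : seq nat) (t : int).

(** Common shape of the denominators of [D1], with [u = lam], [v = 1 - al], and of [D2], with
    [u = - lam - al - 1], [v = 1 - al + t1']; both are instances by conversion. *)
Definition Dden t (pos : seq nat) u v : R :=
  if t < 0 then \prod_(k < `|t|%N | nat_of_ord k \notin pos) (u - k%:R)
  else if 0 < t then rfact v `|t|%N else 1.

Definition Dnum t a w : R :=
  if t < 0 then ffact a `|t|%N else if 0 < t then rfact w `|t|%N else 1.

Lemma Dden_nonpos j pos u v :
  Dden (- j%:Z) pos u v = \prod_(k < j | nat_of_ord k \notin pos) (u - k%:R).
Proof.
rewrite /Dden; case: j => [|j]; first by rewrite oppr0 ltxx big_ord0.
by have -> : (- j.+1%:Z < 0) = true by lia.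
Qed.

Lemma Dden_nonneg j pos u v : Dden j%:Z pos u v = rfact v j.
Proof. by rewrite /Dden; case: j => [|j] //; rewrite rfact0. Qed.

Lemma Dnum_nonpos j a w : Dnum (- j%:Z) a w = ffact a j.
Proof.
rewrite /Dnum; case: j => [|j]; first by rewrite oppr0 ltxx /ffact big_ord0.
by have -> : (- j.+1%:Z < 0) = true by lia.
Qed.

Lemma Dnum_nonneg j a w : Dnum j%:Z a w = rfact w j.
Proof. by rewrite /Dnum; case: j => [|j] //; rewrite rfact0. Qed.

Lemma neg_intP t : t < 0 -> exists j : nat, t = - (j.+1%:Z).
Proof. by move=> t0; exists (`|t|%N).-1; lia. Qed.

Lemma pos_intP t : 0 < t -> exists j : nat, t = j.+1%:Z.
Proof. by move=> t0; exists (`|t|%N).-1; lia. Qed.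

(** The index 0 is excluded on the left and the others move by one. The value [v'] is free because
    [t + 1 <= 0] never reaches the rising factorial. *)
Lemma Dden_down0 t n u v v' : t < 0 ->
  Dden t (rcons (map succn n) 0) u v = Dden (t + 1) n (u - 1) v'.
Proof.
move=> /neg_intP[j ->]; have -> : - j.+1%:Z + 1 = - j%:Z by lia.
rewrite !Dden_nonpos big_mkcond big_ord_recl /= mem_rcons inE eqxx /= mul1r.
rewrite [RHS]big_mkcond; apply: eq_bigr => i _.
rewrite /bump /= add1n mem_rcons inE mem_map_succn /= natrS.
by case: ifP => // _; ring.
Qed.

Lemma Dden_down t n u v v' : t < 0 ->
  Dden t (map succn n) u v = u * Dden (t + 1) n (u - 1) v'.
Proof.
move=> /neg_intP[j ->]; have -> : - j.+1%:Z + 1 = - j%:Z by lia.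
rewrite !Dden_nonpos big_mkcond big_ord_recl /= mem_map_succn /= subr0; congr (_ * _).
rewrite [RHS]big_mkcond; apply: eq_bigr => i _.
rewrite /bump /= add1n mem_map_succn /= natrS.
by case: ifP => // _; ring.
Qed.

Lemma Dnum_down t a w w' : t < 0 -> Dnum t a w = a * Dnum (t + 1) (a - 1) w'.
Proof.
move=> /neg_intP[j ->]; have -> : - j.+1%:Z + 1 = - j%:Z by lia.
rewrite !Dnum_nonpos /ffact big_ord_recl /= subr0; congr (_ * _).
by apply: eq_bigr => i _; rewrite /bump /= add1n natrS; ring.
Qed.

Lemma Dden_up t pos pos' u u' v : 0 < t ->
  Dden t pos u v = v * Dden (t - 1) pos' u' (v + 1).
Proof.
move=> /pos_intP[j ->]; have -> : j.+1%:Z - 1 = j%:Z by lia.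
by rewrite !Dden_nonneg rfactSl.
Qed.

Lemma Dnum_up t a a' w : 0 < t -> Dnum t a w = w * Dnum (t - 1) a' (w + 1).
Proof.
move=> /pos_intP[j ->]; have -> : j.+1%:Z - 1 = j%:Z by lia.
by rewrite !Dnum_nonneg rfactSl.
Qed.

Definition dprod (f : nat -> nat -> R) (A B : seq nat) : R :=
  \prod_(i <- A) \prod_(j <- B) f i j.

Lemma dprod_rcons0l f A B :
  dprod f (rcons (map succn A) 0) B = dprod (fun i => f i.+1) A B * \prod_(j <- B) f 0 j.
Proof. by rewrite /dprod -cats1 big_cat big_seq1 big_map. Qed.

Lemma dprod_rcons0r f A B :
  dprod f A (rcons (map succn B) 0) = dprod (fun i j => f i j.+1) A B * \prod_(i <- A) f i 0.
Proof.
by rewrite /dprod -big_split; apply: eq_bigr => i _; rewrite -cats1 big_cat big_seq1 big_map.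
Qed.

Lemma dprod_succl f A B : dprod f (map succn A) B = dprod (fun i => f i.+1) A B.
Proof. by rewrite /dprod big_map. Qed.

Lemma dprod_succr f A B : dprod f A (map succn B) = dprod (fun i j => f i j.+1) A B.
Proof. by apply: eq_bigr => i _; rewrite big_map. Qed.

Lemma eq_dprod f g A B : f =2 g -> dprod f A B = dprod g A B.
Proof. by move=> fg; apply: eq_bigr => i _; apply: eq_bigr => j _. Qed.

Lemma D3E b q n p m : D3 b (Maya q n) (Maya p m) =
  dprod (fun i j => i%:R + b - j%:R) n p * dprod (fun i j => i%:R + b - j%:R) m q *
  dprod (fun i j => i%:R + j%:R + 1) n q * dprod (fun i j => i%:R + j%:R + 1) m p.
Proof. by []. Qed.

(** Transfers the one-step formulas from the first diagram to the second. *)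
Lemma D3_sym b M N : D3 b M N = D3 b N M.
Proof. by case: M N => [q n] [p m]; rewrite !D3E; ring. Qed.

(** Shifting degrees and [b] together leaves the factors of all surviving pairs unchanged; what
    remains is the row of the removed degree 0, equal up to sign to the Laguerre constants of the
    step. *)
Lemma D3_down_0 b n q N :
  D3 b (Maya q (rcons (map succn n) 0)) N =
  (\prod_(k <- mneg N) (b - k%:R)) * (\prod_(k <- q) (k%:R + 1)) *
  D3 (b + 1) (Maya (map succn q) n) N.
Proof.
case: N => p m; rewrite !D3E !dprod_rcons0l !dprod_succr.
rewrite (@eq_dprod (fun i j => i.+1%:R + b - j%:R) (fun i j => i%:R + (b + 1) - j%:R));
  last by move=> i j; rewrite natrS; ring.
rewrite (@eq_dprod (fun i j => i%:R + (b + 1) - j.+1%:R) (fun i j => i%:R + b - j%:R));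
  last by move=> i j; rewrite natrS; ring.
rewrite (@eq_dprod (fun i j => i.+1%:R + j%:R + 1) (fun i j => i%:R + j.+1%:R + 1));
  last by move=> i j; rewrite !natrS; ring.
have -> : \prod_(j <- p) (0 + b - j%:R) = \prod_(k <- p) (b - k%:R).
  by apply: eq_bigr => j _; rewrite add0r.
have -> : \prod_(j <- q) (0 + j%:R + 1) = \prod_(k <- q) (k%:R + 1) :> R.
  by apply: eq_bigr => j _; rewrite add0r.
by rewrite /=; ring.
Qed.

Lemma D3_up b n q N :
  D3 b (Maya (rcons (map succn q) 0) n) N =
  (\prod_(k <- mpos N) (k%:R + b)) * (\prod_(k <- n) (k%:R + 1)) *
  D3 (b - 1) (Maya q (map succn n)) N.
Proof.
case: N => p m; rewrite !D3E !dprod_rcons0r !dprod_succl.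
rewrite (@eq_dprod (fun i j => i.+1%:R + (b - 1) - j%:R) (fun i j => i%:R + b - j%:R));
  last by move=> i j; rewrite natrS; ring.
rewrite (@eq_dprod (fun i j => i%:R + b - j.+1%:R) (fun i j => i%:R + (b - 1) - j%:R));
  last by move=> i j; rewrite natrS; ring.
rewrite (@eq_dprod (fun i j => i.+1%:R + j%:R + 1) (fun i j => i%:R + j.+1%:R + 1));
  last by move=> i j; rewrite !natrS; ring.
have -> : \prod_(i <- m) (i%:R + b - 0) = \prod_(k <- m) (k%:R + b).
  by apply: eq_bigr => i _; rewrite subr0.
have -> : \prod_(i <- n) (i%:R + 0 + 1) = \prod_(k <- n) (k%:R + 1) :> R.
  by apply: eq_bigr => i _; rewrite addr0.
by rewrite /=; ring.
Qed.

End Constants.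

(** * Iteration *)

Section Induction.
Variable R : realType.
Implicit Types (b lam : R) (M N : maya).

Definition step_const b lam M N : R := D1 b lam M * D2 b lam M N * D3 b M N.

Definition shifted_Omega M N b lam (x : R) : R :=
  let b' := b - (tprime M)%:~R - (tprime N)%:~R in
  Omega (maya_shift M (tprime M)) (maya_shift N (tprime N)) b'
    (htilde b' (lam + (tprime M)%:~R)) x.

Definition reduces M N b lam : Prop :=
  exists2 s, pm s & forall x, 0 < x ->
    Omega M N b (htilde b lam) x = s * step_const b lam M N * shifted_Omega M N b lam x.

(** The invariant of the iteration. The final parameter does not change along it, and the
    denominators of [D1] and [D2] only lose factors. *)
Definition admissible M N b lam : Prop :=
  [/\ maya_wf M, maya_wf N,
      forall k : nat, 1 - b + k%:R != 0,
      forall k : nat, 1 - (b - (tprime M)%:~R - (tprime N)%:~R) + k%:R != 0 &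
      D1den b lam M != 0 /\ D2den b lam M N != 0].

Lemma reduces_step M N M' N' b b' lam lam' (C : R) :
  (exists2 s, pm s & forall x, 0 < x ->
     Omega M N b (htilde b lam) x = s * C * Omega M' N' b' (htilde b' lam') x) ->
  step_const b lam M N = C * step_const b' lam' M' N' ->
  shifted_Omega M N b lam = shifted_Omega M' N' b' lam' ->
  reduces M' N' b' lam' -> reduces M N b lam.
Proof.
move=> [s ps H] EC ES [s' ps' H']; exists (s * s'); first exact: pmM.
by move=> x x0; rewrite H // H' // EC ES; ring.
Qed.

Lemma reduces_step_inv M N M' N' b b' lam lam' (C : R) : C != 0 ->
  (exists2 s, pm s & forall x, 0 < x ->
     Omega M' N' b' (htilde b' lam') x = s * C * Omega M N b (htilde b lam) x) ->
  step_const b' lam' M' N' = C * step_const b lam M N ->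
  shifted_Omega M N b lam = shifted_Omega M' N' b' lam' ->
  reduces M' N' b' lam' -> reduces M N b lam.
Proof.
move=> C0 [s ps H] EC; apply: (@reduces_step _ _ _ _ _ _ _ _ C^-1).
  exists s => // x x0; rewrite H //.
  set O := Omega _ _ _ _ _.
  have -> : s * C^-1 * (s * C * O) = (s * s) * (C^-1 * C) * O by ring.
  by rewrite pm_sqr // mulVf // !mul1r.
by rewrite EC mulKf.
Qed.

Lemma prod_subC b (l : seq nat) :
  exists2 s : R, pm s & \prod_(k <- l) (k%:R - b) = s * \prod_(k <- l) (b - k%:R).
Proof.
exists (\prod_(k <- l) -1); first by apply: big_const_pm; right.
by rewrite -big_split /=; apply: eq_bigr => k _; rewrite mulN1r opprB.
Qed.

Lemma int_le0 (c : R) (z : int) :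
  (forall k : nat, 1 - c + k%:R != 0) -> c = z%:~R -> z <= 0.
Proof.
move=> c0 cz; rewrite leNgt; apply/negP => z0.
have [j zj] := pos_intP z0.
by have := c0 j; rewrite cz zj -pmulrn natrS; apply/negP/negPn/eqP; ring.
Qed.

Lemma prod_nat1_neq0 (l : seq nat) : \prod_(k <- l) (k%:R + 1) != 0 :> R.
Proof. by rewrite prodf_seq_neq0; apply/allP => k _ /=; rewrite natr1 pnatr_eq0. Qed.

(** If [b = 0], the final parameter [- t1' - t2'] must be nonpositive, so [t2' >= - t1' > 0]. Then
    the rising factorial of length [t2'] based at [1 + t1'] in the denominator of [D2] passes
    through 0. *)
Lemma admissible_down1_neq0 M N b lam : admissible M N b lam -> tprime M < 0 -> b != 0.
Proof.
move=> [_ _ _ bf [_ D2n]] t1; apply/eqP => b0.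
have := int_le0 (z := - tprime M - tprime N) bf.
have E (u v : int) : (- u - v)%:~R = - u%:~R - v%:~R :> R by rewrite intrB intrN.
rewrite b0 sub0r E => /(_ erefl) h.
have t2 : 0 < tprime N by lia.
move: D2n; rewrite -[D2den _ _ _ _]/(Dden (tprime N) (mpos N) (- lam - b - 1)
  (1 - b + (tprime M)%:~R)).
have [j tj] := pos_intP t2; have [i ti] := neg_intP t1.
rewrite tj Dden_nonneg b0 ti => /prodf_neq0 H.
have ij : (i < j.+1)%N by lia.
have := H (Ordinal ij) isT; rewrite /= intrN -pmulrn natrS.
by apply/negP/negPn/eqP; ring.
Qed.

(** The only new condition is the one for [k = 0], which reads [- b != 0]. *)
Lemma lower_param_down b : b != 0 -> (forall k : nat, 1 - b + k%:R != 0) ->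
  forall k : nat, 1 - (b + 1) + k%:R != 0.
Proof.
move=> b0 bk [|k]; first by rewrite addr0 opprD addrCA subrr addr0 oppr_eq0.
rewrite (_ : _ + _ = 1 - b + k%:R) //.
by rewrite natrS; ring.
Qed.

Lemma lower_param_up b : (forall k : nat, 1 - b + k%:R != 0) ->
  forall k : nat, 1 - (b - 1) + k%:R != 0.
Proof.
move=> bk k; rewrite (_ : _ + _ = 1 - b + k.+1%:R) //.
by rewrite natrS; ring.
Qed.

(* The factors [k + b + 1] can only vanish when the final parameter is a
   positive integer. *)
Lemma admissible_down1_prod_neq0 M N b lam : admissible M N b lam -> tprime M < 0 ->
  \prod_(k <- mpos N) (k%:R + (b + 1)) != 0.
Proof.
move=> [_ wN _ bf _] t1; rewrite prodf_seq_neq0; apply/allP => k kN /=; apply/eqP => kb.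
have := tprime_mpos wN kN.
have := int_le0 (z := - k%:Z - 1 - tprime M - tprime N) bf.
have -> : b = - k%:R - 1 by apply/eqP; rewrite -subr_eq0 -kb; apply/eqP; ring.
have E (u v : int) : (- k%:Z - 1 - u - v)%:~R = - k%:R - 1 - u%:~R - v%:~R :> R.
  by rewrite !intrB intrN.
by rewrite E => /(_ erefl); lia.
Qed.

(** Translating a diagram first does not alter its canonical form, and the remaining shift corrects
    [b] and [lam] accordingly. *)
Lemma shifted_Omega_step1 M M' N b b' lam lam' (s : int) :
  maya_wf M -> maya_wf M' -> (forall k, maya_mem M' k = maya_mem M (k - s)) ->
  tprime M' = tprime M - s -> b' = b - s%:~R -> lam' = lam + s%:~R ->
  shifted_Omega M N b lam = shifted_Omega M' N b' lam'.
Proof.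
move=> wM wM' E Et -> ->; rewrite /shifted_Omega Et (maya_shift_step _ wM wM' E).
have -> : b - s%:~R - (tprime M - s)%:~R = b - (tprime M)%:~R by rewrite intrB; ring.
by have -> : lam + s%:~R + (tprime M - s)%:~R = lam + (tprime M)%:~R by rewrite intrB; ring.
Qed.

Lemma shifted_Omega_step2 M N N' b b' lam (s : int) :
  maya_wf N -> maya_wf N' -> (forall k, maya_mem N' k = maya_mem N (k - s)) ->
  tprime N' = tprime N - s -> b' = b - s%:~R ->
  shifted_Omega M N b lam = shifted_Omega M N' b' lam.
Proof.
move=> wN wN' E Et ->; rewrite /shifted_Omega Et (maya_shift_step _ wN wN' E).
by have -> : b - s%:~R - (tprime M)%:~R - (tprime N - s)%:~R =
  b - (tprime M)%:~R - (tprime N)%:~R by rewrite intrB; ring.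
Qed.

Lemma shift1_params M M' N b b' lam lam' (s : int) :
  tprime M' = tprime M - s -> b' = b - s%:~R -> lam' = lam + s%:~R ->
  [/\ D2den b lam M N = D2den b' lam' M' N, D2num b lam M N = D2num b' lam' M' N &
      b' - (tprime M')%:~R = b - (tprime M)%:~R].
Proof.
move=> Et -> ->; have EtR : (tprime M')%:~R = (tprime M)%:~R - s%:~R :> R by rewrite Et intrB.
split; last by rewrite EtR; ring.
- rewrite -[LHS]/(Dden (tprime N) (mpos N) (- lam - b - 1) (1 - b + (tprime M)%:~R)).
  rewrite -[RHS]/(Dden (tprime N) (mpos N) (- (lam + s%:~R) - (b - s%:~R) - 1)
    (1 - (b - s%:~R) + (tprime M')%:~R)) EtR.
  by congr Dden; ring.
- rewrite -[LHS]/(Dnum (tprime N) (- b + (tprime M)%:~R) (- lam - b)).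
  rewrite -[RHS]/(Dnum (tprime N) (- (b - s%:~R) + (tprime M')%:~R)
    (- (lam + s%:~R) - (b - s%:~R))) EtR.
  by congr Dnum; ring.
Qed.

(** * Steps on the first diagram *)

Lemma reduces_down1_0 q n N b lam : sorted gtn n ->
  let M := Maya q (rcons (map succn n) 0) in let M' := Maya (map succn q) n in
  admissible M N b lam -> tprime M < 0 ->
  admissible M' N (b + 1) (lam - 1) /\
  (reduces M' N (b + 1) (lam - 1) -> reduces M N b lam).
Proof.
move=> sn M M' adm t1; have b0 := admissible_down1_neq0 adm t1.
case: (adm) => wM wN bk bf [D1n D2n].
have wM' : maya_wf M' by split=> //=; rewrite sorted_gtn_map_succn; case: wM.
have Et1 : tprime M' = tprime M + 1 by exact: tprime_down0.
have Et : tprime M' = tprime M - (-1) by rewrite opprK.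
have bk' := lower_param_down b0 bk.
have Eb : b + 1 = b - (-1)%:~R by rewrite mulrN1z opprK.
have El : lam - 1 = lam + (-1)%:~R by rewrite mulrN1z.
have [D2d D2u Ef] := shift1_params N Et Eb El.
have D1d : D1den b lam M = D1den (b + 1) (lam - 1) M'.
  by have := Dden_down0 n lam (1 - b) (1 - (b + 1)) t1; rewrite -Et1.
have D1u : D1num b lam M = - b * D1num (b + 1) (lam - 1) M'.
  have := Dnum_down (- b) (lam + 1) (lam - 1 + 1) t1; rewrite -Et1.
  by have -> : - b - 1 = - (b + 1) by ring.
split; first by split=> //; [move=> k; rewrite Ef|rewrite -D1d -D2d].
apply: (@reduces_step _ _ _ _ _ _ _ _
  ((\prod_(k <- mneg N) (b - k%:R)) * (\prod_(k <- q) (k%:R + 1)) * - b)).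
- case: N {adm wN bf D2n D2d D2u} => p m /=.
  have [s ps H] := Omega_down1_0 n q m p lam bk bk'.
  have [s' ps' E'] := prod_subC b p.
  by exists (s * s'); [exact: pmM|move=> x x0; rewrite H // E'; ring].
- by rewrite /step_const /D1 /D2 D1d D2d D1u D2u D3_down_0; ring.
- apply: (@shifted_Omega_step1 _ _ _ _ _ _ _ (-1)) => //.
  by move=> k; rewrite maya_mem_down0 opprK.
Qed.

Lemma reduces_down1 q n N b lam : sorted gtn n -> n != [::] ->
  let M := Maya q (map succn n) in let M' := Maya (rcons (map succn q) 0) n in
  admissible M N b lam -> tprime M < 0 ->
  admissible M' N (b + 1) (lam - 1) /\
  (reduces M' N (b + 1) (lam - 1) -> reduces M N b lam).
Proof.
move=> sn nn M M' adm t1; have b0 := admissible_down1_neq0 adm t1.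
have P0 := admissible_down1_prod_neq0 adm t1.
case: (adm) => wM wN bk bf [D1n D2n].
have wM' : maya_wf M' by split=> //=; apply: sorted_gtn_rcons0; case: wM.
have Et1 : tprime M' = tprime M + 1 by exact: tprime_down.
have Et : tprime M' = tprime M - (-1) by rewrite opprK.
have bk' := lower_param_down b0 bk.
have Eb : b + 1 = b - (-1)%:~R by rewrite mulrN1z opprK.
have El : lam - 1 = lam + (-1)%:~R by rewrite mulrN1z.
have [D2d D2u Ef] := shift1_params N Et Eb El.
have D1d : D1den b lam M = lam * D1den (b + 1) (lam - 1) M'.
  by have := Dden_down n lam (1 - b) (1 - (b + 1)) t1; rewrite -Et1.
have D1u : D1num b lam M = - b * D1num (b + 1) (lam - 1) M'.
  have := Dnum_down (- b) (lam + 1) (lam - 1 + 1) t1; rewrite -Et1.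
  by have -> : - b - 1 = - (b + 1) by ring.
(* Since 0 is missing from the diagram, [lam] itself is a factor of the denominator of [D1]. *)
have [lam0 D1n'] : lam != 0 /\ D1den (b + 1) (lam - 1) M' != 0.
  by apply/andP; rewrite -negb_or -mulf_eq0 -D1d.
split; first by split=> //; [move=> k; rewrite Ef|rewrite -D2d].
(* This is the constant of [Omega_up1] at the parameters [b + 1] and [lam - 1], to be inverted. *)
apply: (@reduces_step_inv _ _ _ _ _ _ _ _
  ((\prod_(k <- mpos N) (k%:R + (b + 1))) * (\prod_(k <- n) (k%:R + 1)) * (lam / - b))).
- by rewrite !mulf_neq0 // ?prod_nat1_neq0 // invr_eq0 oppr_eq0.
- case: N {adm wN bf D2n D2d D2u P0} => p m /=.
  have bk2 k : 1 - (b + 1 - 1) + k%:R != 0 by rewrite addrK.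
  have [s ps H] := Omega_up1 n q m p (lam - 1) bk' bk2.
  exists s => // x x0; rewrite H // addrK subrK.
  by have -> : 1 - (b + 1) = - b by ring.
- rewrite /step_const /D1 /D2 D1d D2d D1u D2u D3_up addrK.
  by field; rewrite ?b0 ?lam0 ?D1n' -?D2d ?D2n.
- apply: (@shifted_Omega_step1 _ _ _ _ _ _ _ (-1)) => //.
  by move=> k; rewrite maya_mem_down opprK.
Qed.

Lemma reduces_up1 q N b lam : sorted gtn q ->
  let M := Maya (rcons (map succn q) 0) [::] in let M' := Maya q [::] in
  admissible M N b lam ->
  admissible M' N (b - 1) (lam + 1) /\
  (reduces M' N (b - 1) (lam + 1) -> reduces M N b lam).
Proof.
move=> sq M M' [wM wN bk bf [D1n D2n]].
have t1 : 0 < tprime M by rewrite /tprime /maya_max /= mex_rcons0; lia.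
have wM' : maya_wf M' by [].
have Et : tprime M' = tprime M - 1 by exact: tprime_up.
have bk' := lower_param_up bk.
have [D2d D2u Ef] := shift1_params N Et (erefl (b - 1%:~R)) (erefl (lam + 1%:~R)).
rewrite mulr1z in D2d D2u Ef.
have D1d : D1den b lam M = (1 - b) * D1den (b - 1) (lam + 1) M'.
  have := Dden_up [::] [::] lam (lam + 1) (1 - b) t1; rewrite -Et.
  by have -> : 1 - b + 1 = 1 - (b - 1) by ring.
have D1u : D1num b lam M = (lam + 1) * D1num (b - 1) (lam + 1) M'.
  by have := Dnum_up (- b) (- (b - 1)) (lam + 1) t1; rewrite -Et.
have [b1 D1n'] : 1 - b != 0 /\ D1den (b - 1) (lam + 1) M' != 0.
  by apply/andP; rewrite -negb_or -mulf_eq0 -D1d.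
split; first by split=> //; [move=> k; rewrite Ef|rewrite -D2d].
apply: (@reduces_step _ _ _ _ _ _ _ _
  ((\prod_(k <- mpos N) (k%:R + b)) * (\prod_(k <- [::]) (k%:R + 1)) * ((lam + 1) / (1 - b)))).
- case: N {wN bf D2n D2d D2u Ef} => p m /=.
  exact: Omega_up1.
- rewrite /step_const /D1 /D2 D1d D2d D1u D2u D3_up.
  by field; rewrite ?b1 ?D1n' -?D2d ?D2n.
- apply: (@shifted_Omega_step1 _ _ _ _ _ _ _ 1) => //.
  by move=> k; rewrite (maya_mem_down q [::]) subrK.
Qed.

(** * Steps on the second diagram, the first being canonical *)

Lemma admissible_down2_neq0 M N b lam :
  admissible M N b lam -> tprime M = 0 -> tprime N < 0 -> b != 0.
Proof.
move=> [_ _ _ bf _] t0 t2; apply/eqP => b0.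
(* For [b = 0] the final parameter would be the positive integer [- t2']. *)
have := int_le0 (z := - tprime N) bf.
by rewrite b0 t0 intrN subr0 sub0r => /(_ erefl); lia.
Qed.

Lemma D1_0 b lam M : tprime M = 0 -> D1 b lam M = 1.
Proof. by move=> t0; rewrite /D1 /D1num /D1den t0 /= divr1. Qed.

Lemma D2den_0 b lam M N : tprime M = 0 ->
  D2den b lam M N = Dden (tprime N) (mpos N) (- lam - b - 1) (1 - b).
Proof. by move=> t0; rewrite /D2den t0 addr0. Qed.

Lemma D2num_0 b lam M N : tprime M = 0 ->
  D2num b lam M N = Dnum (tprime N) (- b) (- lam - b).
Proof. by move=> t0; rewrite /D2num t0 addr0. Qed.

Lemma reduces_down2_0 q m p M b lam : sorted gtn m ->
  let N := Maya p (rcons (map succn m) 0) in let N' := Maya (map succn p) m in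
  M = Maya q [::] -> tprime M = 0 -> admissible M N b lam -> tprime N < 0 ->
  admissible M N' (b + 1) lam /\ (reduces M N' (b + 1) lam -> reduces M N b lam).
Proof.
move=> sm N N' EM t0 adm t2; have b0 := admissible_down2_neq0 adm t0 t2.
case: (adm) => wM wN bk bf [D1n D2n].
have wN' : maya_wf N' by split=> //=; rewrite sorted_gtn_map_succn; case: wN.
have Et1 : tprime N' = tprime N + 1 by exact: tprime_down0.
have bk' := lower_param_down b0 bk.
have Ef : b + 1 - (tprime N')%:~R = b - (tprime N)%:~R by rewrite Et1 intrD; ring.
have D2d : D2den b lam M N = D2den (b + 1) lam M N'.
  rewrite !D2den_0 // (@Dden_down0 _ _ m _ _ (1 - (b + 1)) t2) -Et1.
  by have -> : - lam - b - 1 - 1 = - lam - (b + 1) - 1 by ring.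
have D2u : D2num b lam M N = - b * D2num (b + 1) lam M N'.
  rewrite !D2num_0 // (@Dnum_down _ _ _ _ (- lam - (b + 1)) t2) -Et1.
  by have -> : - b - 1 = - (b + 1) by ring.
split.
  split=> //; first by move=> k; rewrite t0 subr0 Ef; have := bf k; rewrite t0 subr0.
  by rewrite -D2d /D1den t0 oner_neq0.
apply: (@reduces_step _ _ _ _ _ _ _ _
  ((\prod_(k <- mneg M) (b - k%:R)) * (\prod_(k <- p) (k%:R + 1)) * - b)).
- rewrite {}EM {adm wM bf D1n D2n D2d D2u t0} /=.
  have [s ps H] := Omega_down2_0 [::] q m p lam bk bk'.
  have [s' ps' E'] := prod_subC b q.
  by exists (s * s'); [exact: pmM|move=> x x0; rewrite H // E'; ring].
- by rewrite /step_const !D1_0 // /D2 D2d D2u D3_sym D3_down_0 D3_sym; ring.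
- apply: (@shifted_Omega_step2 _ _ _ _ _ _ (-1)) => //.
  + by move=> k; rewrite maya_mem_down0 opprK.
  + by rewrite opprK.
Qed.

Lemma reduces_down2 q m p M b lam : sorted gtn m -> m != [::] ->
  let N := Maya p (map succn m) in let N' := Maya (rcons (map succn p) 0) m in
  M = Maya q [::] -> tprime M = 0 -> admissible M N b lam -> tprime N < 0 ->
  admissible M N' (b + 1) lam /\ (reduces M N' (b + 1) lam -> reduces M N b lam).
Proof.
move=> sm mn N N' EM t0 adm t2; have b0 := admissible_down2_neq0 adm t0 t2.
case: (adm) => wM wN bk bf [D1n D2n].
have wN' : maya_wf N' by split=> //=; apply: sorted_gtn_rcons0; case: wN.
have Et1 : tprime N' = tprime N + 1 by exact: tprime_down.
have bk' := lower_param_down b0 bk.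
have Ef : b + 1 - (tprime N')%:~R = b - (tprime N)%:~R by rewrite Et1 intrD; ring.
have D2d : D2den b lam M N = (- lam - b - 1) * D2den (b + 1) lam M N'.
  rewrite !D2den_0 // (@Dden_down _ _ m _ _ (1 - (b + 1)) t2) -Et1.
  by have -> : - lam - b - 1 - 1 = - lam - (b + 1) - 1 by ring.
have D2u : D2num b lam M N = - b * D2num (b + 1) lam M N'.
  rewrite !D2num_0 // (@Dnum_down _ _ _ _ (- lam - (b + 1)) t2) -Et1.
  by have -> : - b - 1 = - (b + 1) by ring.
have [u0 D2n'] : - lam - b - 1 != 0 /\ D2den (b + 1) lam M N' != 0.
  by apply/andP; rewrite -negb_or -mulf_eq0 -D2d.
split.
  split=> //; first by move=> k; rewrite t0 subr0 Ef; have := bf k; rewrite t0 subr0.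
  by rewrite /D1den t0 oner_neq0.
(* This is the constant of [Omega_up2] at [b + 1]; its product over the elements of [M] is empty
   because [M] is canonical. *)
apply: (@reduces_step_inv _ _ _ _ _ _ _ _
  ((\prod_(k <- m) (k%:R + 1)) * ((- lam - b - 1) / - b))).
- by rewrite !mulf_neq0 // ?prod_nat1_neq0 // invr_eq0 oppr_eq0.
- rewrite {}EM {adm wM bf D1n D2n D2n' D2d D2u t0} /=.
  have bk2 k : 1 - (b + 1 - 1) + k%:R != 0 by rewrite addrK.
  have [s ps H] := Omega_up2 [::] q m p lam bk' bk2.
  exists s => // x x0; rewrite H // addrK big_nil mul1r.
  have -> : 1 - (b + 1) = - b by ring.
  by have -> : - lam - (b + 1) = - lam - b - 1 by ring.
- rewrite /step_const !D1_0 // /D2 D2d D2u D3_sym D3_up addrK [D3 _ N M]D3_sym EM /= big_nil.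
  by field; rewrite -EM D2n' u0 b0.
- apply: (@shifted_Omega_step2 _ _ _ _ _ _ (-1)) => //.
  + by move=> k; rewrite maya_mem_down opprK.
  + by rewrite opprK.
Qed.

Lemma reduces_up2 q p M b lam : sorted gtn p ->
  let N := Maya (rcons (map succn p) 0) [::] in let N' := Maya p [::] in
  M = Maya q [::] -> tprime M = 0 -> admissible M N b lam ->
  admissible M N' (b - 1) lam /\ (reduces M N' (b - 1) lam -> reduces M N b lam).
Proof.
move=> sp N N' EM t0 [wM wN bk bf [D1n D2n]].
have t2 : 0 < tprime N by rewrite /tprime /maya_max /= mex_rcons0; lia.
have Et1 : tprime N' = tprime N - 1 by exact: tprime_up.
have bk' := lower_param_up bk.
have Ef : b - 1 - (tprime N')%:~R = b - (tprime N)%:~R by rewrite Et1 intrB; ring.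
have D2d : D2den b lam M N = (1 - b) * D2den (b - 1) lam M N'.
  rewrite !D2den_0 // (@Dden_up _ _ _ [::] _ (- lam - (b - 1) - 1) _ t2) -Et1.
  by have -> : 1 - b + 1 = 1 - (b - 1) by ring.
have D2u : D2num b lam M N = (- lam - b) * D2num (b - 1) lam M N'.
  rewrite !D2num_0 // (@Dnum_up _ _ _ (- (b - 1)) _ t2) -Et1.
  by have -> : - lam - b + 1 = - lam - (b - 1) by ring.
have [b1 D2n'] : 1 - b != 0 /\ D2den (b - 1) lam M N' != 0.
  by apply/andP; rewrite -negb_or -mulf_eq0 -D2d.
split.
  split=> //; first by move=> k; rewrite t0 subr0 Ef; have := bf k; rewrite t0 subr0.
  by rewrite /D1den t0 oner_neq0.
apply: (@reduces_step _ _ _ _ _ _ _ _ ((- lam - b) / (1 - b))).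
- rewrite {}EM {wM bf D1n D2n D2n' D2d D2u t0} /=.
  have [s ps H] := Omega_up2 [::] q [::] p lam bk bk'.
  by exists s => // x x0; rewrite H // !big_nil !mul1r.
- rewrite /step_const !D1_0 // /D2 D2d D2u D3_sym D3_up [D3 _ N' M]D3_sym EM /= !big_nil.
  by field; rewrite -EM D2n' b1.
- apply: (@shifted_Omega_step2 _ _ _ _ _ _ 1) => //.
  by move=> k; rewrite (maya_mem_down p [::]) subrK.
Qed.

(** * Descent on the distance to canonical form *)

Lemma mpos_split M : maya_wf M -> tprime M < 0 -> exists q n,
  sorted gtn n /\ (M = Maya q (rcons (map succn n) 0) \/ n != [::] /\ M = Maya q (map succn n)).
Proof.
case: M => q s [_ /= ss]; have [n sn Es] := sorted_gtn_split ss.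
move: Es; case: ifP => _ -> t0; exists q, n; split=> //; [by left|right; split=> //].
(* Without nonnegative elements [t'] equals [mex] of the holes, which contradicts [t' < 0]. *)
by apply/eqP => n0; move: t0; rewrite n0 /tprime /maya_max /=; lia.
Qed.

Lemma mneg_split M : maya_wf M -> 0 < tprime M -> exists2 q,
  sorted gtn q & M = Maya (rcons (map succn q) 0) [::].
Proof.
move=> wM t0; have pM := tprime_ge0 (ltW t0).
case: M wM t0 pM => s n [/= ss _] t0 n0; rewrite n0 in t0 *.
have s0 : 0%N \in s by apply: mex_gt0; move: t0; rewrite /tprime /maya_max /=; lia.
by have [q sq] := sorted_gtn_split ss; rewrite s0 => ->; exists q.
Qed.

Lemma reduces00 M N b lam : maya_wf M -> maya_wf N -> tprime M = 0 -> tprime N = 0 ->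
  reduces M N b lam.
Proof.
move=> wM wN t1 t2; exists 1; first by left.
have pM : mpos M = [::] by apply: tprime_ge0; rewrite t1.
have pN : mpos N = [::] by apply: tprime_ge0; rewrite t2.
move=> x x0; rewrite /step_const D1_0 // /D2 D2den_0 // D2num_0 // t2.
rewrite /D3 pM pN !big_nil /shifted_Omega t1 t2 !maya_shift0 // !subr0 addr0.
by rewrite /Dden /Dnum /= divr1 !mul1r.
Qed.

Lemma reduces_tprime0 M N b lam : admissible M N b lam -> tprime M = 0 -> reduces M N b lam.
Proof.
move=> adm t1; have [k] := ubnP `|tprime N|%N.
elim: k N b adm => // k IH N b adm; rewrite ltnS => tk.
have [q EM] : exists q, M = Maya q [::].
  by exists (mneg M); rewrite -(@tprime_ge0 M) ?t1 //; case: (M).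
have [wM wN _ _ _] := adm.
have [t2|t2|t2] := ltrgt0P (tprime N); last exact: reduces00.
- have [p sp EN] := mneg_split wN t2; subst N.
  have [adm' red] := reduces_up2 sp EM t1 adm; apply: red; apply: IH => //.
  by move: tk t2; rewrite (tprime_up p); lia.
- have [p [m [sm [EN|[mn EN]]]]] := mpos_split wN t2; subst N.
  + have [adm' red] := reduces_down2_0 sm EM t1 adm t2; apply: red; apply: IH => //.
    by move: tk t2; rewrite tprime_down0 //; lia.
  + have [adm' red] := reduces_down2 sm mn EM t1 adm t2; apply: red; apply: IH => //.
    by move: tk t2; rewrite tprime_down //; lia.
Qed.

Lemma admissible_reduces M N b lam : admissible M N b lam -> reduces M N b lam.
Proof.
have [k] := ubnP `|tprime M|%N.
elim: k M b lam => // k IH M b lam; rewrite ltnS => tk adm.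
have [wM wN _ _ _] := adm.
have [t1|t1|t1] := ltrgt0P (tprime M); last exact: reduces_tprime0.
- have [p sp EM] := mneg_split wM t1; subst M.
  have [adm' red] := reduces_up1 sp adm; apply: red; apply: IH => //.
  by move: tk t1; rewrite (tprime_up p); lia.
- have [p [m [sm [EM|[mn EM]]]]] := mpos_split wM t1; subst M.
  + have [adm' red] := reduces_down1_0 sm adm t1; apply: red; apply: IH => //.
    by move: tk t1; rewrite tprime_down0 //; lia.
  + have [adm' red] := reduces_down1 sm mn adm t1; apply: red; apply: IH => //.
    by move: tk t1; rewrite tprime_down //; lia.
Qed.

End Induction.

Theorem theorem5p5 (R : realType) (al lam : R) (M1 M2 : maya) :
  maya_wf M1 -> maya_wf M2 ->
  (forall k : nat, k \in mneg M2 -> lam != k%:R) ->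
  (* both sides are defined: the lower parameters of the Kummer functions are
     not nonpositive integers, and the denominators of D1, D2 do not vanish *)
  (forall k : nat, 1 - al + k%:R != 0) ->
  (forall k : nat, 1 - (al - (tprime M1)%:~R - (tprime M2)%:~R) + k%:R != 0) ->
  D1den al lam M1 != 0 -> D2den al lam M1 M2 != 0 ->
  exists s : R, (s = 1 \/ s = -1) /\
    forall x : R, 0 < x ->
      Omega M1 M2 al (htilde al lam) x =
      s * (D1 al lam M1 * D2 al lam M1 M2 * D3 al M1 M2) *
      Omega (maya_shift M1 (tprime M1)) (maya_shift M2 (tprime M2))
            (al - (tprime M1)%:~R - (tprime M2)%:~R)
            (htilde (al - (tprime M1)%:~R - (tprime M2)%:~R) (lam + (tprime M1)%:~R)) x.
Proof.
move=> wM wN _ bk bf D1n D2n.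
have adm : admissible M1 M2 al lam by split.
by have [s ps H] := admissible_reduces adm; exists s.
Qed.
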